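(* Let $\mathcal H$ be a separable real Hilbert space, let $\mathbf A,\mathbf B\in\mathcal B_1^+(\mathcal H)$ be covariance operators, and put $\mathcal H_1=\overline{\mathcal R(\mathbf A)}$, $\mathcal H_2=\mathcal N(\mathbf A)$. Then $\mathbf A\leadsto\mathbf B$ (i.e. an optimal pre-pushforward from $\mathbf A$ to $\mathbf B$ exists) if and only if $$\dim[\mathcal R(\mathbf B^{1/2})\cap\mathcal H_2]\le\dim[\mathcal N(\mathbf B^{1/2}\mathbf A^{1/2})\cap\mathcal H_1].$$ If this holds, any optimal pre-pushforward has the form $$\mathbf T=\begin{pmatrix}\mathbf A_{11}^{\dagger/2}(\mathbf A_{11}^{1/2}\mathbf B_{11}\mathbf A_{11}^{1/2})^{1/2}\mathbf A_{11}^{\dagger/2}\\ [(\mathbf A_{11}^{1/2}\mathbf B_{11}\mathbf A_{11}^{1/2})^{\dagger/2}\mathbf A_{11}^{1/2}\mathbf B_{12}+\mathbf U_{12}(\mathbf B/\mathbf A)^{1/2}]^{*}\mathbf A_{11}^{\dagger/2}\end{pmatrix}:\ \mathcal R(\mathbf A^{1/2})\subset\mathcal H_1\to\mathcal H_1\oplus\mathcal H_2,$$ where $\mathbf U_{12}:\mathcal H_2\to\mathcal H_1$ is a partial isometry with initial space $\overline{\mathcal R(\mathbf B/\mathbf A)}$ and final space contained in $\mathcal N(\mathbf B_{11}^{1/2}\mathbf A_{11}^{1/2})$.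
   Context: $\mathcal N(\cdot)$ and $\mathcal R(\cdot)$ denote null space and range. $\mathcal B_1^+(\mathcal H)$ is the set of self-adjoint positive semidefinite trace-class operators on $\mathcal H$ (covariance operators of centered Gaussian measures). Dimensions take values in $\{0,1,2,\dots\}\cup\{\infty\}$. $^\dagger$ is the Moore–Penrose pseudoinverse (for bounded $\mathbf K$, defined on $\mathcal R(\mathbf K)\oplus\mathcal R(\mathbf K)^\perp$, with range $\mathcal N(\mathbf K)^\perp$), and $\mathbf C^{\dagger/2}:=(\mathbf C^{1/2})^\dagger$. Optimal pre-pushforward: a linear operator $\mathbf T:\mathcal R(\mathbf A^{1/2})\subset\mathcal H_1\to\mathcal H$, not necessarily bounded, with (i) $(\mathbf T\mathbf A^{1/2})(\mathbf T\mathbf A^{1/2})^*=\mathbf B$, and (ii) $\operatorname{tr}(\mathbf A^{1/2}\mathbf T\mathbf A^{1/2})=\operatorname{tr}(\mathbf T\mathbf A)=\operatorname{tr}[(\mathbf A^{1/2}\mathbf B\mathbf A^{1/2})^{1/2}]$. (Condition (i) forces $\mathbf T\mathbf A^{1/2}$ to be Hilbert–Schmidt.) Write $\mathbf A\leadsto\mathbf B$ if one exists. Block notation: with $\boldsymbol\Pi_i$ the orthogonal projection onto $\mathcal H_i$, $\mathbf A_{11}=\mathbf A|_{\mathcal H_1}$ and $\mathbf B_{ij}=\boldsymbol\Pi_i\mathbf B|_{\mathcal H_j}:\mathcal H_j\to\mathcal H_i$. The $\mathbf A$-Schur complement of $\mathbf B$ is $\mathbf B/\mathbf A:=\mathbf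 B_{22}-(\mathbf B_{11}^{\dagger/2}\mathbf B_{12})^*(\mathbf B_{11}^{\dagger/2}\mathbf B_{12}):\mathcal H_2\to\mathcal H_2$, which is well defined since $\mathcal R(\mathbf B_{12})\subset\mathcal R(\mathbf B_{11}^{1/2})$. A partial isometry $\mathbf U$ is a bounded operator that is isometric on $\mathcal N(\mathbf U)^\perp$ (its initial space); $\mathcal R(\mathbf U)$ is its final space. *)

(* Defs.v *)
From HB Require Import structures.
From mathcomp Require Import all_boot all_order all_algebra.
From mathcomp Require Import all_classical all_reals all_analysis.

Set Implicit Arguments.
Unset Strict Implicit.
Unset Printing Implicit Defensive.

Import Order.TTheory GRing.Theory Num.Theory.
Import numFieldNormedType.Exports.
Local Open Scope classical_set_scope.
Local Open Scope ring_scope.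

HB.mixin Record CompleteNormedModule_isHilbert (R : realType) H
    & CompleteNormedModule R H := {
  dot : H -> H -> R;
  dotC : forall x y, dot x y = dot y x;
  dotDl : forall x y z, dot (x + y) z = dot x z + dot y z;
  dotZl : forall (a : R) x y, dot (a *: x) y = a * dot x y;
  dotxx : forall x, dot x x = `|x| ^+ 2
}.

#[short(type="hilbertType")]
HB.structure Definition Hilbert (R : realType) :=
  {H of CompleteNormedModule R H & CompleteNormedModule_isHilbert R H}.

Definition separable (T : topologicalType) : Prop :=
  exists2 D : set T, countable D & dense D.

Record closedSubspace (R : realType) (H : hilbertType R) := ClosedSubspace {
  cs_set :> set H;
  cs_zero : cs_set 0;
  cs_linear : forall (a : R) x y, cs_set x -> cs_set y -> cs_set (a *: x + y);
  cs_closed : closed cs_set }.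

(* A closed subspace is itself a Hilbert space, with the restricted inner
   product; its elements are coerced to the ambient space. *)
Section SubspaceType.
Context (R : realType) (H : hilbertType R) (V : closedSubspace H).

Definition cs_mem : {pred H} := fun x => x \in cs_set V.

Lemma cs_submod_closed : submod_closed cs_mem.
Proof.
split; first by apply/mem_set/cs_zero.
by move=> a x y /set_mem Vx /set_mem Vy; apply/mem_set/cs_linear.
Qed.

HB.instance Definition _ :=
  GRing.isSubmodClosed.Build R H cs_mem
    (GRing.submod_closed_semi cs_submod_closed).

Record subsp := Subsp { sub_val :> H; sub_valP : sub_val \in cs_mem }.

HB.instance Definition _ := [isSub for sub_val].
HB.instance Definition _ := [Choice of subsp by <:].
HB.instance Definition _ := [SubChoice_isSubLmodule of subsp by <:].

Let normD (x y : subsp) : `|sub_val (x + y)| <= `|sub_val x| + `|sub_val y|.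
Proof. exact: ler_normD. Qed.
Let normZ (l : R) (x : subsp) : `|sub_val (l *: x)| = `|l| * `|sub_val x|.
Proof. exact: normrZ. Qed.
Let norm0_eq0 (x : subsp) : `|sub_val x| = 0 -> x = 0.
Proof. by move/normr0_eq0 => x0; apply: val_inj. Qed.

HB.instance Definition _ :=
  Lmodule_isNormed.Build R subsp normD normZ norm0_eq0.

Let complete (F : set_system subsp) : ProperFilter F -> cauchy F -> cvg F.
Proof.
move=> FF Fc.
pose G : set_system H := fmap sub_val F.
have GF : ProperFilter G by exact: fmap_proper_filter.
have : cauchy G.
  apply/cauchy_ballP => e e0; have /cauchy_ballP/(_ _ e0) := Fc.
  case=> -[P Q] [/= FP FQ] PQ.
  exists ([set sub_val x | x in P], [set sub_val x | x in Q]).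
    by split; [apply: filterS FP => x Px; exists x|
               apply: filterS FQ => x Px; exists x].
  move=> [_ _] [/= [x Px <-] [y Qy <-]].
  have := PQ (x, y) (conj Px Qy).
  by rewrite /= -!ball_normE.
move=> /cauchy_cvg Gl.
have Vl : cs_set V (lim G).
  apply: (closed_cvg (cs_set V) (@cs_closed _ _ V) _ _ Gl).
  by apply: nearW => x; apply: set_mem; exact: sub_valP.
apply/cvg_ex; exists (Subsp (mem_set Vl)).
apply/cvgrPdist_lt => e e0.
have /cvgrPdist_lt/(_ _ e0) := Gl.
exact.
Qed.

HB.instance Definition _ := Uniform_isComplete.Build subsp complete.

Definition sub_dot (x y : subsp) : R := dot (sub_val x) (sub_val y).

Let sub_dotC x y : sub_dot x y = sub_dot y x.
Proof. exact: dotC. Qed.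
Let sub_dotDl x y z : sub_dot (x + y) z = sub_dot x z + sub_dot y z.
Proof. exact: dotDl. Qed.
Let sub_dotZl (a : R) x y : sub_dot (a *: x) y = a * sub_dot x y.
Proof. exact: dotZl. Qed.
Let sub_dotxx x : sub_dot x x = `|x| ^+ 2.
Proof. exact: dotxx. Qed.

HB.instance Definition _ := CompleteNormedModule_isHilbert.Build R subsp
  sub_dotC sub_dotDl sub_dotZl sub_dotxx.
End SubspaceType.

Section Subspaces.
Context (R : realType).

Definition lin_indep (E : lmodType R) (n : nat) (v : 'I_n -> E) : Prop :=
  forall c : 'I_n -> R, \sum_(i < n) c i *: v i = 0 -> forall i, c i = 0.

(* Algebraic dimension of a (not necessarily closed) linear subspace, with
   values in {0, 1, 2, ...} U {+oo}; infinite cardinals are not told apart. *)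
Definition subdim (E : lmodType R) (V : set E) : \bar R :=
  ereal_sup [set (n%:R)%:E | n in
    [set n | exists v : 'I_n -> E, lin_indep v /\ forall i, V (v i)]].

Definition orthc (H : hilbertType R) (S : set H) : set H :=
  [set x | forall y, S y -> dot x y = 0].

Definition oproj (H : hilbertType R) (V : closedSubspace H) (x : H) : subsp V :=
  xget 0 [set p : subsp V | orthc V (x - sub_val p)].

End Subspaces.

Section Operators.
Context (R : realType).
Implicit Types H K : hilbertType R.

Definition bounded_op H K (f : H -> K) : Prop := linear f /\ continuous f.

Definition nullsp H K (f : H -> K) : set H := [set x | f x = 0].

Definition is_adjoint H K (f : H -> K) (g : K -> H) : Prop :=
  forall x y, dot (f x) y = dot x (g y).

(* The adjoint of f when it exists as an everywhere defined map, else 0. *)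
Definition adj H K (f : H -> K) : K -> H :=
  xget (fun=> 0) [set g | is_adjoint f g].

Definition psd_op H (f : H -> H) : Prop :=
  [/\ bounded_op f, is_adjoint f f & forall x, 0 <= dot (f x) x].

Definition sqrtop H (f : H -> H) : H -> H :=
  xget (fun=> 0) [set g | psd_op g /\ g \o g = f].

(* Moore-Penrose pseudoinverse: f^+ (f x + z) = x for x in N(f)^perp and
   z in R(f)^perp; the value 0 off the domain R(f) (+) R(f)^perp is junk. *)
Definition pinv H K (f : H -> K) (y : K) : H :=
  xget 0 [set x | orthc (nullsp f) x /\
                  exists2 z, orthc (range f) z & y = f x + z].

(* Orthonormal bases are enumerated by nat, possibly interspersed with zero
   vectors, so that finite-dimensional spaces are covered as well. *)
Definition orthonormal_basis H (e : nat -> H) : Prop :=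
  [/\ forall n, e n = 0 \/ `|e n| = 1,
      forall m n, m <> n -> dot (e m) (e n) = 0
    & forall x, (forall n, dot x (e n) = 0) -> x = 0].

Definition trace_class H (f : H -> H) : Prop :=
  bounded_op f /\ forall e, orthonormal_basis e ->
    cvgn (series (fun n => dot (sqrtop (adj f \o f) (e n)) (e n))).

(* Basis-independent trace; junk 0 if there is no common value. *)
Definition optrace H (f : H -> H) : R :=
  xget 0 [set t | forall e, orthonormal_basis e ->
    series (fun n => dot (f (e n)) (e n)) @ \oo --> t].

Definition initial_space H K (U : H -> K) : set H := orthc (nullsp U).

Definition partial_isometry H K (U : H -> K) : Prop :=
  bounded_op U /\ forall x, initial_space U x -> `|U x| = `|x|.

Record covop H := Covop {
  cov_fun :> H -> H;
  cov_psd : psd_op cov_fun;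
  cov_trace_class : trace_class cov_fun }.

Lemma bounded_op0 H K (f : H -> K) : bounded_op f -> f 0 = 0.
Proof.
by case=> lf _; have := lf (-1) 0 0; rewrite scaler0 addr0 scaleN1r addNr.
Qed.

Lemma closure_range_linear H K (f : H -> K) (a : R) x y :
  bounded_op f -> closure (range f) x -> closure (range f) y ->
  closure (range f) (a *: x + y).
Proof.
move=> [lf _] cx cy B Bxy.
have cont : continuous (fun p : K * K => a *: p.1 + p.2).
  move=> p; apply: cvgD; last exact: cvg_snd.
  by apply: cvgZl_tmp; exact: cvg_fst.
have [[P Q] [/= Px Qy] PQ] := cont (x, y) B Bxy.
have [_ [[u _ <-] Pu]] := cx _ Px.
have [_ [[v _ <-] Qv]] := cy _ Qy.
exists (f (a *: u + v)); split; first by exists (a *: u + v).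
by rewrite lf; exact: (PQ (f u, f v)).
Qed.

Definition clrange H K (f : H -> K) (bf : bounded_op f) : closedSubspace K.
Proof.
refine (@ClosedSubspace _ _ (closure (range f)) _ _ (@closed_closure _ _)).
- by apply: subset_closure; exists 0 => //; exact: bounded_op0.
- by move=> a x y; exact: closure_range_linear.
Defined.

Definition clnull H K (f : H -> K) (bf : bounded_op f) : closedSubspace H.
Proof.
refine (@ClosedSubspace _ _ (nullsp f) _ _ _).
- exact: bounded_op0.
- by move=> a x y fx fy; rewrite /nullsp /= bf.1 fx fy scaler0 addr0.
- have -> : nullsp f = f @^-1` [set 0] by [].
  apply: preimage_closed; first by move=> x _; exact: bf.2.
  exact/accessible_closed_set1/hausdorff_accessible/norm_hausdorff.
Defined.

End Operators.

Section Pushforward.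
Context (R : realType) (H : hilbertType R).
Implicit Types A B : covop H.

Definition cov_bounded A : bounded_op A := let: And3 b _ _ := cov_psd A in b.

Definition cov_H1 A : closedSubspace H := clrange (cov_bounded A).
Definition cov_H2 A : closedSubspace H := clnull (cov_bounded A).

Definition block (V W : closedSubspace H) (f : H -> H) : subsp W -> subsp V :=
  oproj V \o f \o @sub_val R H W.
Arguments block V W f : clear implicits.

(* Since R(A) is contained in H1, this is the restriction of A to H1. *)
Definition A11 A := block (cov_H1 A) (cov_H1 A) A.
Definition B11 A B := block (cov_H1 A) (cov_H1 A) B.
Definition B12 A B := block (cov_H1 A) (cov_H2 A) B.
Definition B22 A B := block (cov_H2 A) (cov_H2 A) B.

Arguments A11 A : clear implicits.
Arguments B11 A B : clear implicits.
Arguments B12 A B : clear implicits.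
Arguments B22 A B : clear implicits.

Definition schur A B : subsp (cov_H2 A) -> subsp (cov_H2 A) :=
  let C := pinv (sqrtop (B11 A B)) \o B12 A B in
  fun x => B22 A B x - adj C (C x).

Arguments schur A B : clear implicits.

(* T is only meaningful on R(A^{1/2}), where it is linear but possibly
   unbounded. In the second clause B is everywhere defined, so the equality of
   operators entails that the adjoint of T A^{1/2} is everywhere defined too.
   That clause makes T A^{1/2} Hilbert-Schmidt, so the operators under the
   traces are trace class. *)
Definition optimal_pre_pushforward A B (T : H -> H) : Prop :=
  let sA := sqrtop A in
  let S := T \o sA in
  [/\ forall (a : R) x y, range sA x -> range sA y ->
        T (a *: x + y) = a *: T x + T y,
      is_adjoint S (adj S) /\ S \o adj S = B,
      optrace (sA \o T \o sA) = optrace (T \o A)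
    & optrace (T \o A) = optrace (sqrtop (sA \o B \o sA))].

Definition leadsto A B : Prop := exists T, optimal_pre_pushforward A B T.

Definition pushforward_gram A B : subsp (cov_H1 A) -> subsp (cov_H1 A) :=
  sqrtop (A11 A) \o B11 A B \o sqrtop (A11 A).

Arguments pushforward_gram A B : clear implicits.

(* The two rows of the block form of T, as maps into H1 and H2. *)
Definition pushforward1 A B : subsp (cov_H1 A) -> subsp (cov_H1 A) :=
  pinv (sqrtop (A11 A)) \o sqrtop (pushforward_gram A B)
    \o pinv (sqrtop (A11 A)).

Definition pushforward2 A B (U12 : subsp (cov_H2 A) -> subsp (cov_H1 A)) :
    subsp (cov_H1 A) -> subsp (cov_H2 A) :=
  adj (fun y => pinv (sqrtop (pushforward_gram A B))
                  (sqrtop (A11 A) (B12 A B y))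
                + U12 (sqrtop (schur A B) y))
    \o pinv (sqrtop (A11 A)).

End Pushforward.

Arguments block {R H} V W f.
Arguments A11 {R H} A.
Arguments B11 {R H} A B.
Arguments B12 {R H} A B.
Arguments B22 {R H} A B.
Arguments schur {R H} A B.
Arguments pushforward_gram {R H} A B.
Arguments pushforward1 {R H} A B.
Arguments pushforward2 {R H} A B U12.

(* Main.v *)
(* Put [S = T A^(1/2)]. Condition (i) says [S S^* = B]. As
   [(A^(1/2) S) (A^(1/2) S)^* = A^(1/2) B A^(1/2)], the polar decomposition gives
   [A^(1/2) S = P V] with [P = (A^(1/2) B A^(1/2))^(1/2)] and [V] a contraction,
   and equality of the traces of [P V] and [P] forces [P V = P]. So the optimal
   pre-pushforwards correspond to the bounded [S] vanishing on [N(A)] with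
   [S S^* = B] and [A^(1/2) S = P].
   Such an [S^*] equals [W B^(1/2)] with [W] isometric on the closed range of
   [B^(1/2)], and [W] is prescribed on the range of [B^(1/2) A^(1/2)]. It remains
   to embed isometrically the complement of that range, which [B^(1/2)] maps
   injectively onto [R(B^(1/2)) /\ N(A)], into [N(B^(1/2) A^(1/2)) /\ H1]:
   this is possible exactly under the dimension condition. The blocks of [T] are
   read off from [P S^* = A^(1/2) B], which determines [S^*] on [N(A)] up to its
   component [D] in [N(P)]; since [D^* D = B/A], polar decomposition of [D]
   produces [U12]. *)
From HB Require Import structures.
Require Import Defs.
From mathcomp Require Import all_boot all_order all_algebra.
From mathcomp Require Import all_classical all_reals all_analysis.
From mathcomp Require Import ring lra.
Import Order.TTheory GRing.Theory Num.Theory.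
Import numFieldNormedType.Exports.
Local Open Scope classical_set_scope.
Local Open Scope ring_scope.

Set Implicit Arguments.
Unset Strict Implicit.
Unset Printing Implicit Defensive.

(** * Bounded operators on Hilbert spaces *)

(** Operators are compared through the norms of their values: [S^*] and [B^(1/2)], or [S^* A^(1/2)]
    and [P], have equal norms at every vector. The lemma [isometric_factor] turns each such equality
    into a partial isometry with its adjoint; the contraction [V], the isometry [W] and [U12] all
    come from it. [T] may be unbounded and [P] is not assumed trace class. Traces are therefore
    computed as pairings of two Hilbert-Schmidt operators, one of them [A^(1/2)]; for such pairings
    independence of the basis follows from Parseval and polarization. The space [R(B^(1/2)) /\ N(A)]
    need not be closed, whereas isometries are built from orthonormal sequences in closed subspaces.
    Necessity only lifts independent vectors through [S]; sufficiency only uses that [B^(1/2)]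
    injects a closed space into that intersection. Not telling infinite dimensions apart is
    harmless: in a separable space a closed subspace is spanned by an orthonormal sequence, and only
    finite prefixes of such sequences are compared. *)

Section LinearMaps.
Context (R : realType) (E F G : lmodType R).
Implicit Types (f : E -> F) (g : F -> G).

Lemma lin0 f : linear f -> f 0 = 0.
Proof. by move=> lf; have := lf (-1) 0 0; rewrite scaler0 addr0 scaleN1r addNr. Qed.

Lemma linD f x y : linear f -> f (x + y) = f x + f y.
Proof. by move=> lf; have := lf 1 x y; rewrite !scale1r. Qed.

Lemma linZ f a x : linear f -> f (a *: x) = a *: f x.
Proof. by move=> lf; have := lf a x 0; rewrite !addr0 (lin0 lf) addr0. Qed.

Lemma linN f x : linear f -> f (- x) = - f x.
Proof. by move=> lf; rewrite -scaleN1r linZ// scaleN1r. Qed.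

Lemma linB f x y : linear f -> f (x - y) = f x - f y.
Proof. by move=> lf; rewrite linD// linN. Qed.

Lemma lin_sum f (I : Type) (r : seq I) (P : pred I) (u : I -> E) : linear f ->
  f (\sum_(i <- r | P i) u i) = \sum_(i <- r | P i) f (u i).
Proof.
move=> lf; elim/big_rec2: _ => [|i x y _ <-]; first exact: lin0.
exact: linD.
Qed.

Lemma lin_comp f g : linear f -> linear g -> linear (g \o f).
Proof. by move=> lf lg a x y /=; rewrite lf lg. Qed.

Lemma lin_add f f' : linear f -> linear f' -> linear (fun x => f x + f' x).
Proof. by move=> lf lf' a x y /=; rewrite lf lf' scalerDr addrACA. Qed.

Lemma lin_scale c f : linear f -> linear (fun x => c *: f x).
Proof. by move=> lf a x y /=; rewrite lf scalerDr !scalerA mulrC. Qed.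

End LinearMaps.

Section InnerProduct.
Context (R : realType) (H : hilbertType R).
Implicit Types (x y z : H) (a : R).

Lemma dotDr x y z : dot x (y + z) = dot x y + dot x z.
Proof. by rewrite dotC dotDl !(dotC x). Qed.

Lemma dotZr a x y : dot x (a *: y) = a * dot x y.
Proof. by rewrite dotC dotZl dotC. Qed.

Lemma dot0l x : dot 0 x = 0 :> R.
Proof. by rewrite -(scale0r x) dotZl mul0r. Qed.

Lemma dot0r x : dot x 0 = 0 :> R.
Proof. by rewrite dotC dot0l. Qed.

Lemma dotNl x y : dot (- x) y = - dot x y.
Proof. by rewrite -scaleN1r dotZl mulN1r. Qed.

Lemma dotNr x y : dot x (- y) = - dot x y.
Proof. by rewrite dotC dotNl dotC. Qed.

Lemma dotBl x y z : dot (x - y) z = dot x z - dot y z.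
Proof. by rewrite dotDl dotNl. Qed.

Lemma dotBr x y z : dot x (y - z) = dot x y - dot x z.
Proof. by rewrite dotDr dotNr. Qed.

Lemma dot_suml (I : Type) (r : seq I) (P : pred I) (u : I -> H) x :
  dot (\sum_(i <- r | P i) u i) x = \sum_(i <- r | P i) dot (u i) x.
Proof.
by elim/big_rec2: _ => [|i y z _ <-]; rewrite ?dot0l// dotDl.
Qed.

Lemma dot_sumr (I : Type) (r : seq I) (P : pred I) (u : I -> H) x :
  dot x (\sum_(i <- r | P i) u i) = \sum_(i <- r | P i) dot x (u i).
Proof. by rewrite dotC dot_suml; apply: eq_bigr => i _; rewrite dotC. Qed.

Lemma dot_ge0 x : 0 <= dot x x :> R.
Proof. by rewrite dotxx sqr_ge0. Qed.

Lemma dot_eq0 x : dot x x = 0 :> R -> x = 0.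
Proof. by rewrite dotxx => /eqP; rewrite sqrf_eq0 normr_eq0 => /eqP. Qed.

Lemma dot_ext x y : (forall z, dot x z = dot y z :> R) -> x = y.
Proof.
move=> xy; apply/eqP; rewrite -subr_eq0; apply/eqP/dot_eq0.
by rewrite dotBl xy subrr.
Qed.

Lemma sqnormD x y : `|x + y| ^+ 2 = `|x| ^+ 2 + 2 * dot x y + `|y| ^+ 2 :> R.
Proof. by rewrite -!dotxx dotDl !dotDr (dotC y x); ring. Qed.

Lemma sqnormB x y : `|x - y| ^+ 2 = `|x| ^+ 2 - 2 * dot x y + `|y| ^+ 2 :> R.
Proof. by rewrite sqnormD dotNr normrN mulrN. Qed.

Lemma dot_polar x y : dot x y = (`|x + y| ^+ 2 - `|x - y| ^+ 2) / 4 :> R.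
Proof. by rewrite sqnormD sqnormB; field. Qed.

Lemma cauchy_schwarz x y : `|dot x y| <= `|x| * `|y| :> R.
Proof.
have [->|y0] := eqVneq y 0; first by rewrite dot0r !normr0 mulr0.
have ny : 0 < `|y| :> R by rewrite normr_gt0.
have : 0 <= `|(`|y| ^+ 2) *: x - dot x y *: y| ^+ 2 :> R by rewrite sqr_ge0.
rewrite -dotxx dotBl !dotBr !dotZl !dotZr (dotC y x) !dotxx.
have -> (a b c : R) : b ^+ 2 * (b ^+ 2 * a ^+ 2) - b ^+ 2 * (c * c) -
    (c * (b ^+ 2 * c) - c * (c * b ^+ 2)) =
    b ^+ 2 * ((a * b) ^+ 2 - c ^+ 2) by ring.
rewrite pmulr_rge0 ?exprn_gt0// subr_ge0 -(real_normK (num_real (dot x y))).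
by rewrite ler_pXn2r// nnegrE mulr_ge0.
Qed.

Lemma norm_le_dot x (M : R) : 0 <= M -> (forall y, dot x y <= M * `|y|) ->
  `|x| <= M.
Proof.
move=> M0 /(_ x); rewrite dotxx expr2.
have [->|x0] := eqVneq x 0; first by rewrite normr0.
by rewrite ler_pM2r// normr_gt0.
Qed.

End InnerProduct.

Section Bounded.
Context (R : realType).
Implicit Types H K L : hilbertType R.

Lemma bop_intro H K (f : H -> K) (M : R) :
  linear f -> (forall x, `|f x| <= M * `|x|) -> bounded_op f.
Proof.
move=> lf fM; split => //.
pose g := GRing.isLinear.Build _ _ _ _ f lf.
pose F : {linear H -> K} := HB.pack f g.
apply: (@bounded_linear_continuous _ _ _ F); apply/linear_boundedP.
near=> r => x; apply: le_trans (fM x) _; apply: ler_wpM2r => //.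
Unshelve. all: by end_near. Qed.

Lemma bop_bound H K (f : H -> K) :
  bounded_op f -> exists2 M : R, 0 < M & forall x, `|f x| <= M * `|x|.
Proof.
move=> [lf cf].
pose g := GRing.isLinear.Build _ _ _ _ f lf.
pose F : {linear H -> K} := HB.pack f g.
have /linear_bounded_continuous/linear_boundedP : continuous F by [].
move=> /pinfty_ex_gt0[M M0 FM]; by exists M.
Qed.

Lemma bop_comp H K L (f : H -> K) (g : K -> L) :
  bounded_op f -> bounded_op g -> bounded_op (g \o f).
Proof.
move=> [lf cf] [lg cg]; split; first exact: lin_comp.
by move=> x; apply: continuous_comp; [exact: cf|exact: cg].
Qed.

Lemma bop_add H K (f g : H -> K) :
  bounded_op f -> bounded_op g -> bounded_op (fun x => f x + g x).
Proof.
move=> [lf cf] [lg cg]; split; first exact: lin_add.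
by move=> x; apply: cvgD; [exact: cf|exact: cg].
Qed.

Lemma bop_scale H K (c : R) (f : H -> K) :
  bounded_op f -> bounded_op (fun x => c *: f x).
Proof.
move=> [lf cf]; split; first exact: lin_scale.
by move=> x; apply: cvgZl_tmp; exact: cf.
Qed.

Lemma bop_sub H K (f g : H -> K) :
  bounded_op f -> bounded_op g -> bounded_op (fun x => f x - g x).
Proof.
move=> bf bg; have := bop_add bf (bop_scale (-1) bg).
by congr (bounded_op _); apply/funext => x; rewrite scaleN1r.
Qed.

Lemma bop_id H : bounded_op (@id H).
Proof. by split => // x. Qed.

Lemma cvg_dot (H : hilbertType R) (u : nat -> H) (l x : H) :
  u @ \oo --> l -> (fun n => dot (u n) x : R) @ \oo --> (dot l x : R).
Proof.
move=> /cvgrPdist_lt ul; apply/cvgrPdist_lt => e e0.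
have x0 : 0 < `|x| + 1 :> R by rewrite ltr_wpDl.
have := ul (e / (`|x| + 1)); rewrite divr_gt0// => /(_ isT).
apply: filterS => n; rewrite ltr_pdivlMr// => lt; rewrite -dotBl.
apply: le_lt_trans (cauchy_schwarz _ _) (le_lt_trans _ lt).
by rewrite ler_wpM2l// lerDl.
Qed.

Lemma cauchy_seq_cvg (H : hilbertType R) (u : nat -> H) :
  (forall e : R, 0 < e -> exists N, forall m n, (N <= m)%N -> (N <= n)%N ->
     `|u m - u n| < e) -> exists l : H, u @ \oo --> l.
Proof.
move=> uc; suff /cauchy_cvg ul : cauchy (u @ \oo) by exists (lim (u @ \oo)).
apply/cauchy_ballP => e e0; have [N uN] := uc _ e0.
exists (u @` [set n | (N <= n)%N], u @` [set n | (N <= n)%N]).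
  by split; exists N => // n Nn; exists n.
move=> [_ _] [/= [m Nm <-] [n Nn <-]]; rewrite -ball_normE/=.
exact: uN.
Qed.

End Bounded.

(** * Orthogonal complements and closed spans *)

Section Orthogonality.
Context (R : realType) (H : hilbertType R).
Implicit Types (S : set H) (x y : H).

(** Plays the role of the closed span of [S] while avoiding limits; [range_ocl] identifies it with
    the topological closure when [S] is the range of a linear map. *)
Definition ocl S : set H := orthc (orthc S).

Lemma sub_ocl S : S `<=` ocl S.
Proof. by move=> x Sx y Sy; rewrite dotC Sy. Qed.

Lemma orthc_sub S S' : S `<=` S' -> orthc S' `<=` orthc S.
Proof. by move=> SS' x Sx y /SS'; exact: Sx. Qed.

Lemma orthc_ocl S : orthc (ocl S) = orthc S.
Proof.
apply/seteqP; split; last exact: sub_ocl.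
exact/orthc_sub/sub_ocl.
Qed.

Lemma orthc0 S : orthc S 0.
Proof. by move=> y _; exact: dot0l. Qed.

Lemma orthcP S (a : R) x y : orthc S x -> orthc S y -> orthc S (a *: x + y).
Proof.
by move=> Sx Sy z Sz; rewrite dotDl dotZl Sx// Sy// mulr0 addr0.
Qed.

Lemma orthcD S x y : orthc S x -> orthc S y -> orthc S (x + y).
Proof. by move=> Sx Sy; rewrite -(scale1r x); exact: orthcP. Qed.

Lemma orthcN S x : orthc S x -> orthc S (- x).
Proof. by move=> Sx; rewrite -scaleN1r -(addr0 (_ *: _)); exact/orthcP/orthc0. Qed.

Lemma orthcB S x y : orthc S x -> orthc S y -> orthc S (x - y).
Proof. by move=> Sx Sy; apply/orthcD => //; exact: orthcN. Qed.

Lemma orthc_cap0 S x : orthc S x -> ocl S x -> x = 0.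
Proof. by move=> Sx /(_ _ Sx)/dot_eq0. Qed.

Lemma orthc_closed S : closed (orthc S).
Proof.
have -> : orthc S = \bigcap_(y in S) (fun x => dot x y) @^-1` [set 0].
  by apply/seteqP; split => x Sx y; exact: Sx.
apply: closed_bigI => y _; apply: preimage_closed; last exact: closed_eq.
move=> x _; apply/cvgrPdist_lt => e e0.
have y0 : 0 < `|y| + 1 :> R by rewrite ltr_wpDl.
near=> z; rewrite -dotBl; apply: le_lt_trans (cauchy_schwarz _ _) _.
apply: (@le_lt_trans _ _ (`|x - z| * (`|y| + 1))); first by rewrite ler_wpM2l// lerDl.
rewrite -ltr_pdivlMr//; near: z.
by apply: cvgr_dist_lt; rewrite ?divr_gt0//; exact: cvg_id.
Unshelve. all: by end_near. Qed.

Definition orthcs S : closedSubspace H :=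
  ClosedSubspace (@orthc0 S) (@orthcP S) (@orthc_closed S).

Lemma closureP S x : closure S x <->
  forall e : R, 0 < e -> exists2 y, S y & `|x - y| < e.
Proof.
split=> [cSx e e0|Sx B /nbhs_ballP[e /= e0 eB]].
  have [y [Sy]] := cSx _ (nbhsx_ballx x e e0).
  by rewrite -ball_normE /= => xy; exists y.
have [y Sy xy] := Sx _ e0; exists y; split => //; apply: eB.
by rewrite -ball_normE.
Qed.

Lemma closure_ocl S : closure S `<=` ocl S.
Proof.
have /closure_id cS : closed (ocl S) by exact: orthc_closed.
by rewrite [X in _ `<=` X]cS; exact/closure_subset/sub_ocl.
Qed.

End Orthogonality.

(** * Riesz representation, adjoints and projections *)

Section Variational.
Context (R : realType).
Implicit Types H K L : hilbertType R.

(* [u] is the limit of [P x_n] along a minimizing sequence of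
   [|P x|^2 - 2 phi x]. With [P = id] this is the Riesz representation theorem,
   with [P] an inclusion the projection theorem. *)
Lemma variational (E : lmodType R) H (P : E -> H) (phi : E -> R) (c : R) :
  linear P -> (forall a x y, phi (a *: x + y) = a * phi x + phi y) ->
  0 <= c -> (forall x, `|phi x| <= c * `|P x|) ->
  exists u, [/\ closure (range P) u, `|u| <= c & forall x, phi x = dot (P x) u].
Proof.
move=> lP lphi c0 phic.
pose J x : R := `|P x| ^+ 2 - 2 * phi x.
have Jge x : - c ^+ 2 <= J x.
  have := phic x; rewrite ler_norml => /andP[_ pc].
  have := sqr_ge0 (`|P x| - c); rewrite /J; nra.
have Jinf : has_inf (range J).
  by split; [exists (J 0); exists 0|exists (- c ^+ 2) => _ [x _ <-]].
pose m := inf (range J).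
have mJ x : m <= J x by apply: (ge_inf Jinf.2); exists x.
have /choice[u uP] : forall n : nat, exists x, J x < m + n.+1%:R^-1.
  move=> n; have [||_ [x _ <-]] := @inf_adherent _ (range J) n.+1%:R^-1 => //.
  by exists x.
have phiZ a x : phi (a *: x) = a * phi x.
  have phi0 : phi 0 = 0 by have := lphi 1 0 0; rewrite scaler0 addr0; lra.
  by rewrite -[_ *: _]addr0 lphi phi0 addr0.
have phiD x y : phi (x + y) = phi x + phi y.
  by have := lphi 1 x y; rewrite scale1r mul1r.
(* Parallelogram law. As [J] is at least [m] at the midpoint, two points where [J] is close to [m]
   have close images under [P], so the minimizing sequence has Cauchy images. *)
have midJ x y : `|P x - P y| ^+ 2 = 2 * J x + 2 * J y - 4 * J (2^-1 *: (x + y)).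
  rewrite /J (linZ _ _ lP) (linD _ _ lP) normrZ phiZ phiD.
  by rewrite exprMn gtr0_norm// sqnormB sqnormD; field.
have [v uv] : exists l : H, P \o u @ \oo --> l.
  apply: cauchy_seq_cvg => e e0.
  have [N _ Ne] : \forall n \near \oo, n.+1%:R^-1 < e ^+ 2 / 4.
    apply: (@cvgr_lt R^o _ _ _ (@harmonic R) 0); first exact: cvg_harmonic.
    by rewrite divr_gt0// exprn_gt0.
  exists N => p q Np Nq; rewrite -(@ltr_pXn2r _ 2)// ?nnegrE ?(ltW e0)//=.
  have := midJ (u p) (u q); have := mJ (2^-1 *: (u p + u q)).
  have := uP p; have := uP q; have /= := Ne _ Np; have /= := Ne _ Nq.
  by move: q.+1%:R^-1 p.+1%:R^-1 => a b; lra.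
have phiv x : phi x = dot (P x) v.
  set q := `|P x| ^+ 2; set d := dot v (P x) - phi x.
  suff d0 : d = 0 by move: d0; rewrite /d dotC => /subr0_eq.
  have key t : 0 <= 2 * t * d + t ^+ 2 * q.
    have un n : - n.+1%:R^-1 <= 2 * t * (dot (P (u n)) (P x) - phi x) + t ^+ 2 * q.
      have := mJ (t *: x + u n); rewrite /J lP lphi sqnormD normrZ dotZl exprMn.
      rewrite real_normK ?num_real// (dotC (P x)) -/q; have := uP n; rewrite /J.
      by move: n.+1%:R^-1 => b; lra.
    have l0 : (fun n => - n.+1%:R^-1 : R) @ \oo --> (0 : R).
      by rewrite -oppr0; apply: cvgN; exact: cvg_harmonic.
    apply: (ler_cvg_to l0 _ (nearW _ un)).
    + apply: cvgD; last exact: cvg_cst.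
      apply: cvgM; first exact: cvg_cst.
      by apply: cvgB; [exact: cvg_dot|exact: cvg_cst].
  have q0 : 0 <= q by exact: sqr_ge0.
  (* The minimizer of the quadratic would be [- d / q]; the added 1 covers [q = 0] and still gives a
     negative value unless [d = 0]. *)
  have := key (- d / (q + 1)).
  have -> : 2 * (- d / (q + 1)) * d + (- d / (q + 1)) ^+ 2 * q =
    - (d ^+ 2 * (q + 2) / (q + 1) ^+ 2) by field; rewrite gt_eqF//; lra.
  have ? : 0 < q + 2 by lra.
  rewrite oppr_ge0 pmulr_lle0 ?invr_gt0 ?exprn_gt0 ?ltr_wpDl// pmulr_lle0//.
  by move=> d2; apply/eqP; rewrite -sqrf_eq0 eq_le d2 sqr_ge0.
exists v; split => //.
- apply: (closed_cvg _ (@closed_closure _ _) _ _ uv); apply: nearW => n.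
  by apply: subset_closure; exists (u n).
- have : `|v| ^+ 2 <= c * `|v|.
    have un n : dot (P (u n)) v <= c * `|P (u n)|.
      by rewrite -phiv; exact: le_trans (ler_norm _) (phic _).
    rewrite -dotxx; apply: (ler_cvg_to (cvg_dot uv) _ (nearW _ un)).
    by apply: cvgM; [exact: cvg_cst|exact: cvg_norm].
  have [->|v0] := eqVneq v 0; first by rewrite normr0.
  by rewrite expr2 ler_pM2r// normr_gt0.
Qed.

End Variational.

Section Adjoints.
Context (R : realType).
Implicit Types H K L : hilbertType R.

(** The functional [dot (P e) x] is represented by some [u] in the closure of the range; [u - x] is
    both orthogonal to the range and in its double complement, hence zero. *)
Lemma range_ocl (E : lmodType R) H (P : E -> H) : linear P ->
  closure (range P) = ocl (range P).
Proof.
move=> lP; apply/seteqP; split; first exact: closure_ocl.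
move=> x xP; have [|||u [uP _ ux]] :=
  @variational _ _ _ P (fun e => dot (P e) x) `|x| lP.
- by move=> a y z; rewrite lP dotDl dotZl.
- by [].
- by move=> y; rewrite mulrC; exact: cauchy_schwarz.
suff <- : u = x by [].
apply/eqP; rewrite -subr_eq0; apply/eqP.
apply: (@orthc_cap0 _ _ (range P)); last by apply: orthcB => //; exact: closure_ocl.
by move=> _ [e _ <-]; rewrite dotC dotBr -ux subrr.
Qed.

Lemma is_adjointC H K (f : H -> K) g : is_adjoint f g -> is_adjoint g f.
Proof. by move=> fg x y; rewrite dotC -fg dotC. Qed.

Lemma adjE H K (f : H -> K) g : is_adjoint f g -> adj f = g.
Proof.
move=> fg; rewrite /adj; case: xgetP => [h _ fh|/(_ g)//].
by apply/funext => y; apply: dot_ext => x; rewrite dotC -fh fg dotC.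
Qed.

Lemma is_adjoint_comp H K L (f : H -> K) (g : K -> L) f' g' :
  is_adjoint f f' -> is_adjoint g g' -> is_adjoint (g \o f) (f' \o g').
Proof. by move=> ff gg x y /=; rewrite gg ff. Qed.

Lemma is_adjoint_add H K (f g : H -> K) f' g' :
  is_adjoint f f' -> is_adjoint g g' ->
  is_adjoint (fun x => f x + g x) (fun y => f' y + g' y).
Proof. by move=> ff gg x y; rewrite dotDl dotDr ff gg. Qed.

Lemma is_adjoint_sub H K (f g : H -> K) f' g' :
  is_adjoint f f' -> is_adjoint g g' ->
  is_adjoint (fun x => f x - g x) (fun y => f' y - g' y).
Proof. by move=> ff gg x y; rewrite dotBl dotBr ff gg. Qed.

Lemma is_adjoint_scale H K (c : R) (f : H -> K) f' :
  is_adjoint f f' -> is_adjoint (fun x => c *: f x) (fun y => c *: f' y).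
Proof. by move=> ff x y; rewrite dotZl dotZr ff. Qed.

Lemma is_adjoint_lin H K (f : H -> K) g : is_adjoint f g -> linear f.
Proof.
by move=> fg a x y; apply: dot_ext => z; rewrite fg dotDl dotZl dotDl dotZl !fg.
Qed.

Lemma is_adjoint_bop H K (f : H -> K) g : is_adjoint f g -> bounded_op f ->
  bounded_op g.
Proof.
move=> fg /bop_bound[M M0 fM]; apply: (bop_intro (M := M)).
  exact/is_adjoint_lin/is_adjointC.
move=> y; apply: norm_le_dot => [|x]; first by rewrite mulr_ge0// ltW.
rewrite dotC -fg (le_trans (ler_norm _))// (le_trans (cauchy_schwarz _ _))//.
by rewrite mulrAC ler_wpM2r.
Qed.

Lemma bop_adj H K (f : H -> K) : bounded_op f -> is_adjoint f (adj f).
Proof.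
move=> bf; have [M M0 fM] := bop_bound bf.
suff /choice[g fg] : forall y, exists u, forall x, dot (f x) y = dot x u.
  have fg' : is_adjoint f g by move=> x y.
  by rewrite (adjE fg').
move=> y; have [||||u [_ _ uf]] :=
  @variational _ _ _ (@id H) (fun x => dot (f x) y) (M * `|y|).
- by [].
- by move=> a x z; rewrite bf.1 dotDl dotZl.
- by rewrite mulr_ge0// ltW.
- move=> x; rewrite (le_trans (cauchy_schwarz _ _))// mulrAC ler_wpM2r//.
by exists u.
Qed.

Lemma null_adj H K (f : H -> K) g : is_adjoint f g -> nullsp f = orthc (range g).
Proof.
move=> fg; apply/seteqP; split=> [x fx _ [y _ <-]|x fx].
  by rewrite -fg (fx : f x = 0) dot0l.
by apply: dot_ext => y; rewrite dot0l fg fx//; exists y.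
Qed.

Lemma orthc_null H K (f : H -> K) g : is_adjoint f g ->
  orthc (nullsp f) = ocl (range g).
Proof. by move=> /null_adj ->. Qed.

Lemma sqnorm_adj H K (f : H -> K) g x : is_adjoint f g ->
  `|f x| ^+ 2 = dot x (g (f x)).
Proof. by move=> fg; rewrite -dotxx fg. Qed.

End Adjoints.

Section Projection.
Context (R : realType) (H : hilbertType R) (V : closedSubspace H).
Implicit Types (x y : H) (v : subsp V).

Lemma sub_val_mem v : cs_set V (sub_val v).
Proof. exact/set_mem/sub_valP. Qed.

Lemma sub_val_surj x : cs_set V x -> exists v : subsp V, sub_val v = x.
Proof. by move=> Vx; exists (Subsp (mem_set Vx)). Qed.

Lemma sub_val_lin : linear (@sub_val R H V).
Proof. by []. Qed.

Lemma sub_val_bop : bounded_op (@sub_val R H V).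
Proof. by apply: (bop_intro (M := 1)) => // v; rewrite mul1r. Qed.

Lemma sub_val_inj : injective (@sub_val R H V).
Proof. exact: val_inj. Qed.

Lemma range_sub_val : range (@sub_val R H V) = V.
Proof.
apply/seteqP; split=> [_ [v _ <-]|x /sub_val_surj[v <-]]; first exact: sub_val_mem.
by exists v.
Qed.

(** The representative, inside [V], of the functional [dot (sub_val v) x] is the projection of [x],
    so the default value of [xget] never occurs. Linearity and boundedness of [oproj] are then
    inherited from the inclusion. *)
Lemma oproj_adj : is_adjoint (@oproj R H V) (@sub_val R H V).
Proof.
move=> x v; suff xV : orthc V (x - sub_val (oproj V x)).
  have /eqP := xV _ (sub_val_mem v); rewrite dotBl subr_eq0 => /eqP ->.
  by [].
rewrite /oproj; case: xgetP => // noP; exfalso.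
have [||||u [uV _ xu]] :=
  @variational _ _ _ (@sub_val R H V) (fun v => dot (sub_val v) x) `|x|.
- exact: sub_val_lin.
- by move=> a y z; rewrite sub_val_lin dotDl dotZl.
- by [].
- by move=> y; rewrite mulrC; exact: cauchy_schwarz.
have /sub_val_surj[w wu] : cs_set V u.
  by move: uV; rewrite range_sub_val -(closure_id _).1//; exact: cs_closed.
apply: (noP w) => y /sub_val_surj[z <-].
by rewrite wu dotC dotBr xu subrr.
Qed.

Lemma oproj_lin : linear (@oproj R H V).
Proof. exact: is_adjoint_lin oproj_adj. Qed.

Lemma oproj_bop : bounded_op (@oproj R H V).
Proof. exact: is_adjoint_bop (is_adjointC oproj_adj) sub_val_bop. Qed.

Lemma oprojK v : oproj V (sub_val v) = v.
Proof. by apply: dot_ext => w; rewrite oproj_adj. Qed.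

Lemma oproj_id x : cs_set V x -> sub_val (oproj V x) = x.
Proof. by move=> /sub_val_surj[v <-]; rewrite oprojK. Qed.

Lemma oproj_orthc x : orthc V (x - sub_val (oproj V x)).
Proof.
move=> _ /sub_val_surj[v <-].
by rewrite dotBl -oproj_adj -[dot (sub_val _) _]/(dot (oproj V x) v) subrr.
Qed.

Lemma oproj_eq0 x : orthc V x -> oproj V x = 0.
Proof.
move=> Vx; apply: dot_ext => v; rewrite oproj_adj dot0l Vx//.
exact: sub_val_mem.
Qed.

End Projection.

Lemma orthc_decomp (R : realType) (H : hilbertType R) (S : set H) (x : H) :
  exists y z, [/\ orthc S y, ocl S z & x = y + z].
Proof.
exists (sub_val (oproj (orthcs S) x)), (x - sub_val (oproj (orthcs S) x)); split.
- exact: (sub_val_mem (oproj (orthcs S) x)).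
- exact: (@oproj_orthc _ _ (orthcs S) x).
- by rewrite addrC subrK.
Qed.

(** * Factorization of maps with equal norms *)

Section Douglas.
Context (R : realType) (E : lmodType R) (H K : hilbertType R).

Lemma isometric_polar (P : E -> H) (M : E -> K) : linear P -> linear M ->
  (forall x, `|M x| = `|P x|) -> forall x y, dot (M x) (M y) = dot (P x) (P y).
Proof.
by move=> lP lM MP x y; rewrite !dot_polar -!linD// -!linB// !MP.
Qed.

(** [V y] is the representative, in the closed range of [P], of the functional [dot (M x) y], which
    is bounded by [|y| |P x|] because the norms agree; [W] is the adjoint of [V]. Since [V] takes
    values in that closed range, [W] vanishes on its complement and is a partial isometry. The
    source [E] carries no topology, so the lemma also applies to formal linear combinations. *)
Lemma isometric_factor (P : E -> H) (M : E -> K) : linear P -> linear M ->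
  (forall x, `|M x| = `|P x|) ->
  exists (W : H -> K) (V : K -> H),
    [/\ bounded_op W, bounded_op V, is_adjoint W V,
        forall x, W (P x) = M x &
        [/\ forall x, V (M x) = P x,
            forall z, ocl (range P) z -> V (W z) = z,
            forall z, ocl (range P) z -> `|W z| = `|z|,
            (forall y, ocl (range P) (V y)) &
            (forall z, ocl (range M) (W z)) /\ (forall y, `|V y| <= `|y|)]].
Proof.
move=> lP lM MP.
have /choice[V VP] : forall y, exists u, [/\ ocl (range P) u, `|u| <= `|y| &
    forall x, dot (M x) y = dot (P x) u].
  move=> y; have [|||u [uP uy Mu]] :=
    @variational _ _ _ P (fun x => dot (M x) y) `|y| lP.
  - by move=> a x z; rewrite lM dotDl dotZl.
  - by [].
  - by move=> x; rewrite mulrC -MP; exact: cauchy_schwarz.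
  by exists u; split=> //; exact: closure_ocl.
have Vuniq y u : ocl (range P) u -> (forall x, dot (M x) y = dot (P x) u) -> V y = u.
  have [Vy _ VM] := VP y => uP Mu.
  apply/eqP; rewrite -subr_eq0; apply/eqP.
  apply: (@orthc_cap0 _ _ (range P)); last exact: orthcB.
  by move=> _ [x _ <-]; rewrite dotC dotBr -VM Mu subrr.
have lV : linear V.
  move=> a y z; apply: Vuniq => [|x].
    by apply: orthcP; have [] := VP y; have [] := VP z.
  have [_ _ Vy] := VP y; have [_ _ Vz] := VP z.
  by rewrite !dotDr !dotZr Vy Vz.
have bV : bounded_op V.
  by apply: (bop_intro (M := 1)) => // y; rewrite mul1r; have [] := VP y.
have VW := bop_adj bV; have WV := is_adjointC VW.
have WP x : adj V (P x) = M x.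
  by apply: dot_ext => y; rewrite WV; have [_ _ ->] := VP y.
have VM x : V (M x) = P x.
  apply: Vuniq => [|y]; first by apply: sub_ocl; exists x.
  exact: isometric_polar.
have VWid z : ocl (range P) z -> V (adj V z) = z.
  move=> zP; apply: Vuniq => // x.
  by rewrite dotC WV VM dotC.
exists (adj V), V; split => //; first exact: is_adjoint_bop VW bV.
split => //.
- move=> z zP; apply/eqP; rewrite -(@eqrXn2 _ 2)//; apply/eqP.
  by rewrite -!dotxx WV VWid.
- by move=> y; have [] := VP y.
split; last by move=> y; have [] := VP y.
move=> z y yM; rewrite WV (_ : V y = 0) ?dot0r//.
apply: Vuniq => [|x]; first exact: orthc0.
by rewrite dot0r dotC yM//; exists x.
Qed.

End Douglas.

(** * Square roots of positive operators *)

Section Positive.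
Context (R : realType) (H : hilbertType R).
Implicit Types (f g X : H -> H).

Lemma psd_bop f : psd_op f -> bounded_op f. Proof. by case. Qed.
Lemma psd_adj f : psd_op f -> is_adjoint f f. Proof. by case. Qed.
Lemma psd_lin f : psd_op f -> linear f. Proof. by case=> -[]. Qed.
Lemma psd_ge0 f x : psd_op f -> 0 <= dot (f x) x. Proof. by case. Qed.

Lemma psd_id : psd_op (@id H).
Proof. by split => // [|x]; [exact: bop_id|exact: dot_ge0]. Qed.

Lemma psd_add f g : psd_op f -> psd_op g -> psd_op (fun x => f x + g x).
Proof.
move=> [bf af pf] [bg ag pg]; split; first exact: bop_add.
  exact: is_adjoint_add.
by move=> x; rewrite dotDl addr_ge0.
Qed.

Lemma psd_scale (c : R) f : 0 <= c -> psd_op f -> psd_op (fun x => c *: f x).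
Proof.
move=> c0 [bf af pf]; split; first exact: bop_scale.
  exact: is_adjoint_scale.
by move=> x; rewrite dotZl mulr_ge0.
Qed.

Lemma psd_sandwich (K : hilbertType R) f (h : K -> H) k :
  is_adjoint h k -> bounded_op h -> psd_op f -> psd_op (k \o f \o h).
Proof.
move=> hk bh [bf af pf]; split.
- apply: bop_comp => //; apply: bop_comp => //; exact: is_adjoint_bop hk bh.
- by move=> x y /=; rewrite (is_adjointC hk) af hk.
- by move=> x /=; rewrite (is_adjointC hk).
Qed.

Lemma psd_cauchy_schwarz f x y : psd_op f ->
  dot (f x) y ^+ 2 <= dot (f x) x * dot (f y) y.
Proof.
move=> pf; set b := dot _ y; set p := dot (f x) x; set q := dot (f y) y.
have key t : 0 <= p + 2 * t * b + t ^+ 2 * q.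
  have := psd_ge0 (t *: y + x) pf.
  rewrite (psd_lin pf) dotDl !dotDr !dotZl !dotZr -/p -/q -/b.
  by rewrite (psd_adj pf y) (dotC y) -/b; congr (0 <= _); ring.
have q0 : 0 <= q by exact: psd_ge0.
have [q1|q1] := ltP 0 q.
  have := key (- b / q).
  have -> : p + 2 * (- b / q) * b + (- b / q) ^+ 2 * q = (p * q - b ^+ 2) / q.
    by field; rewrite gt_eqF.
  by rewrite pmulr_lge0 ?invr_gt0// subr_ge0.
have {q1}q1 : q = 0 by apply: le_anti; rewrite q1.
suff -> : b = 0 by rewrite expr0n q1 mulr0.
(* For [q = 0] the quadratic is affine in [t], and this value of [t] makes it equal to -1. *)
apply/eqP/negP => /negP b0; have := key (- (p + 1) / (2 * b)).
have -> : p + 2 * (- (p + 1) / (2 * b)) * b + (- (p + 1) / (2 * b)) ^+ 2 * q = -1.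
  by rewrite q1; field.
by rewrite oppr_ge0 ler10.
Qed.

(** The inequality [f^2 <= f] for [0 <= f <= 1]: apply Cauchy-Schwarz for the form of [f] to [x] and
    [f x], then cancel [|f x|^2]. *)
Lemma psd_contract f x : psd_op f -> (forall y, dot (f y) y <= `|y| ^+ 2) ->
  `|f x| ^+ 2 <= dot (f x) x.
Proof.
move=> pf f1; have := psd_cauchy_schwarz x (f x) pf; rewrite dotxx.
have [->|fx0] := eqVneq (f x) 0; first by rewrite normr0 expr0n dot0l.
have : 0 < `|f x| ^+ 2 by rewrite exprn_gt0// normr_gt0.
have := f1 (f x); have := psd_ge0 x pf.
move: (dot (f (f x)) _) (dot (f x) x) (`|f x| ^+ 2) => a b c b0 ac c0 cab.
rewrite -(ler_pM2r c0) -expr2 (le_trans cab)//.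
by rewrite ler_wpM2l.
Qed.

Lemma psd_null f x : psd_op f -> dot (f x) x = 0 -> f x = 0.
Proof.
move=> pf fx; apply: dot_eq0; apply/eqP; rewrite -sqrf_eq0 eq_le sqr_ge0 andbT.
by have := psd_cauchy_schwarz x (f x) pf; rewrite fx mul0r.
Qed.

(* Polynomials in [X] with nonnegative coefficients. *)
Inductive pcone X : (H -> H) -> Prop :=
| pcone_iter k : pcone X (iter k X)
| pcone_add f g : pcone X f -> pcone X g -> pcone X (fun x => f x + g x)
| pcone_scale (a : R) f : 0 <= a -> pcone X f -> pcone X (fun x => a *: f x).

Lemma iter_lin X k : linear X -> linear (iter k X).
Proof. by move=> lX; elim: k => // k IH a x y /=; rewrite IH lX. Qed.

Lemma pcone_commute X f g x : pcone X f -> linear g ->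
  (forall x, g (X x) = X (g x)) -> g (f x) = f (g x).
Proof.
move=> Xf lg gX; elim: Xf x => {f} [k|f f' _ IH _ IH'|a f _ _ IH] x.
- by elim: k => //= k IH; rewrite gX IH.
- by rewrite linD// IH IH'.
- by rewrite linZ// IH.
Qed.

Lemma pcone_lin X f : linear X -> pcone X f -> linear f.
Proof.
move=> lX; elim=> {f} [k|f g _ lf _ lg|a f _ _ lf].
- exact: iter_lin.
- exact: lin_add.
- exact: lin_scale.
Qed.

Lemma pcone_comp X f g : linear X -> pcone X f -> pcone X g -> pcone X (f \o g).
Proof.
move=> lX Xf Xg; elim: Xf => {f} [k|f f' _ IH _ IH'|a f a0 _ IH].
- elim: Xg => {g} [j|g g' _ IH _ IH'|a g a0 _ IH].
  + have -> : iter k X \o iter j X = iter (k + j) X.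
      by apply/funext => x; rewrite iterD.
    exact: pcone_iter.
  + have -> : iter k X \o (fun x => g x + g' x) =
        (fun x => (iter k X \o g) x + (iter k X \o g') x).
      by apply/funext => x /=; rewrite linD//; exact: iter_lin.
    exact: pcone_add.
  + have -> : iter k X \o (fun x => a *: g x) = (fun x => a *: (iter k X \o g) x).
      by apply/funext => x /=; rewrite linZ//; exact: iter_lin.
    exact: pcone_scale.
- exact: (pcone_add IH IH').
- exact: (pcone_scale a0 IH).
Qed.

(** A product of positive operators need not be positive, so powers are reached two at a time:
    [X^(k+2) = X X^k X] is a congruence of [X^k]. *)
Lemma pcone_psd X f : psd_op X -> pcone X f -> psd_op f.
Proof.
move=> pX; elim=> {f} [k|f g _ pf _ pg|a f a0 _ pf].
- have [n] := ubnP k; elim: n k => // n IH [|[|k]] kn; [exact: psd_id|exact: pX|].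
  have -> : iter k.+2 X = X \o iter k X \o X.
    by apply/funext => x; rewrite /= -iterSr.
  apply: psd_sandwich; [exact: psd_adj|exact: psd_bop|apply: IH].
  by rewrite -ltnS ltnW.
- exact: psd_add.
- exact: psd_scale.
Qed.

(* The fixed point [Y] of the iteration satisfies [(1 - Y)^2 = 1 - X]. *)
Fixpoint visser X n : H -> H :=
  if n is n'.+1 then fun x => 2^-1 *: (X x + visser X n' (visser X n' x))
  else fun=> 0.

Lemma visser_pcone X n : linear X -> pcone X (visser X n).
Proof.
move=> lX; elim: n => [|n IH] /=.
  have -> : (fun=> 0) = (fun x => 0 *: iter 0 X x).
    by apply/funext => x; rewrite scale0r.
  exact/pcone_scale/pcone_iter.
apply: pcone_scale; first by rewrite invr_ge0.
apply: pcone_add; first exact: (pcone_iter X 1).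
exact: pcone_comp.
Qed.

(** Polynomials in [X] commute, so for consecutive iterates [Z], [Y] the next increment is half of
    [(Y + Z) (Y - Z)]. Nonnegative coefficients thus propagate, and the iterates increase. *)
Lemma visser_step_pcone X n : linear X ->
  pcone X (fun x => visser X n.+1 x - visser X n x).
Proof.
move=> lX; elim: n => [|n IH].
  have -> : (fun x => visser X 1 x - visser X 0 x) = (fun x => 2^-1 *: iter 1 X x).
    by apply/funext => x /=; rewrite subr0 addr0.
  by apply: pcone_scale; [rewrite invr_ge0|exact: (pcone_iter X 1)].
pose Y := visser X n.+1; pose Z := visser X n.
have cY : pcone X Y by exact: visser_pcone.
have cZ : pcone X Z by exact: visser_pcone.
have lY := pcone_lin lX cY; have lZ := pcone_lin lX cZ.
have YZ x : Y (Z x) = Z (Y x).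
  by apply: (pcone_commute _ cZ) => // y; apply/esym/(pcone_commute _ cY).
have -> : (fun x => visser X n.+2 x - visser X n.+1 x) =
    (fun x => 2^-1 *: ((fun x => Y x + Z x) \o (fun x => Y x - Z x)) x).
  apply/funext => x.
  rewrite [visser X n.+2 x]/(2^-1 *: (X x + Y (Y x))).
  rewrite [visser X n.+1 x]/(2^-1 *: (X x + Z (Z x))) -scalerBr; congr (_ *: _).
  rewrite /= (linB _ _ lY) (linB _ _ lZ) YZ opprD addrACA subrr add0r.
  by rewrite addrA subrK.
apply: pcone_scale; first by rewrite invr_ge0.
by apply: pcone_comp => //; exact: pcone_add.
Qed.

Lemma visser_mono X m n : linear X -> (n <= m)%N ->
  pcone X (fun x => visser X m x - visser X n x).
Proof.
move=> lX /subnK <-; elim: (m - n)%N => [|k IH].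
  rewrite add0n; have -> : (fun x => visser X n x - visser X n x) =
      (fun x => 0 *: iter 0 X x).
    by apply/funext => x; rewrite scale0r subrr.
  exact/pcone_scale/pcone_iter.
have := pcone_add (visser_step_pcone (k + n) lX) IH.
by congr (pcone X _); apply/funext => x; rewrite addrA subrK.
Qed.

Lemma visser_contract X n x : psd_op X -> (forall y, dot (X y) y <= `|y| ^+ 2) ->
  `|visser X n x| <= `|x|.
Proof.
move=> pX X1; elim: n x => [|n IH] x /=; first by rewrite normr0.
have Xx : `|X x| <= `|x|.
  rewrite -(@ler_pXn2r _ 2) ?nnegrE//.
  exact: le_trans (psd_contract x pX X1) (X1 x).
rewrite normrZ gtr0_norm// mulrC ler_pdivrMr// (le_trans (ler_normD _ _))//.
by rewrite mulr_natr mulr2n lerD// (le_trans (IH _))//.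
Qed.

End Positive.

Section SquareRoot.
Context (R : realType) (H : hilbertType R).
Implicit Types (f g X : H -> H).

Lemma cvg_dot2 (u v : nat -> H) (l m : H) : u @ \oo --> l -> v @ \oo --> m ->
  (fun n => dot (u n) (v n) : R) @ \oo --> (dot l m : R).
Proof.
move=> ul vm; rewrite dot_polar.
have -> : (fun n => dot (u n) (v n) : R) =
    (fun n => (`|u n + v n| ^+ 2 - `|u n - v n| ^+ 2) * 4^-1).
  by apply/funext => n; rewrite dot_polar.
apply: cvgM; last exact: cvg_cst.
rewrite !expr2; under eq_fun do rewrite !expr2.
apply: cvgB; apply: cvgM; apply: cvg_norm; by [apply: cvgD|apply: cvgB].
Qed.

Lemma limR_uniq (u : nat -> R) (a b : R) : u @ \oo --> a -> u @ \oo --> b -> a = b.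
Proof. by move=> ua ub; apply: (cvg_unique _ ua ub); exact: norm_hausdorff. Qed.

(** The real sequence [a] increases and is bounded. Each increment [D] of the iterates satisfies
    [0 <= D <= 1], so [|D x|^2] is at most [dot (D x) x], a difference of two terms of [a]; hence
    the iterates at [x] are Cauchy. *)
Lemma visser_limit X x : psd_op X -> (forall y, dot (X y) y <= `|y| ^+ 2) ->
  exists y : H, (fun n => visser X n x) @ \oo --> y.
Proof.
move=> pX X1; have lX := psd_lin pX.
pose a n := dot (visser X n x) x.
have D m n y : (n <= m)%N -> 0 <= dot (visser X m y - visser X n y) y.
  by move=> nm; have := psd_ge0 y (pcone_psd pX (visser_mono lX nm)).
have V1 n y : dot (visser X n y) y <= `|y| ^+ 2.
  rewrite (le_trans (ler_norm _))// (le_trans (cauchy_schwarz _ _))// expr2.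
  by rewrite ler_wpM2r// visser_contract.
have nda : nondecreasing_seq a.
  by apply/nondecreasing_seqP => n; rewrite -subr_ge0 /a -dotBl D.
have : cvgn a.
  apply: nondecreasing_is_cvgn => //; exists (`|x| ^+ 2) => _ [n _ <-].
  exact: V1.
move=> /cvg_ex[l al].
have al' n : a n <= l.
  by apply: (cvgr_to_ge al); exists n => // m /= nm; exact: nda.
apply: cauchy_seq_cvg => e e0.
have e20 : 0 < e ^+ 2 by rewrite exprn_gt0.
have /cvgrPdist_lt/(_ _ e20)[N _ Ne] := al.
have key n m : (N <= n)%N -> (n <= m)%N -> `|visser X m x - visser X n x| < e.
  move=> Nn nm; rewrite -(@ltr_pXn2r _ 2) ?nnegrE ?(ltW e0)//.
  have pD := pcone_psd pX (visser_mono lX nm).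
  have D1 y : dot (visser X m y - visser X n y) y <= `|y| ^+ 2.
    rewrite dotBl (le_trans _ (V1 m y))// lerBlDr lerDl.
    exact: psd_ge0 _ (pcone_psd pX (visser_pcone n lX)).
  apply: le_lt_trans (psd_contract x pD D1) _; rewrite dotBl -/(a m) -/(a n).
  have := Ne _ Nn => /=; rewrite ger0_norm ?subr_ge0// => lan.
  by apply: le_lt_trans lan; rewrite lerB.
exists N => m n Nm Nn; have [nm|/ltnW mn] := leqP n m; first exact: key.
by rewrite distrC; exact: key.
Qed.

(** Everything passes to the pointwise limit after pairing with a fixed vector. In the fixed-point
    equation one factor of the square is moved across the inner product, so that only pointwise
    convergence is needed. *)
Lemma visser_fixpoint X : psd_op X -> (forall y, dot (X y) y <= `|y| ^+ 2) ->
  exists Y, [/\ psd_op Y, forall x, dot (Y x) x <= `|x| ^+ 2,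
    forall x, Y x = 2^-1 *: (X x + Y (Y x)) &
    forall g, bounded_op g -> (forall x, g (X x) = X (g x)) ->
      forall x, g (Y x) = Y (g x)].
Proof.
move=> pX X1; have lX := psd_lin pX.
have /choice[Y VY] x := visser_limit x pX X1.
have pV n : psd_op (visser X n) by exact: pcone_psd pX (visser_pcone n lX).
have aY : is_adjoint Y Y.
  move=> x y; apply: (limR_uniq (cvg_dot (VY x))).
  have -> : (fun n => dot (visser X n x) y : R) = (fun n => dot (visser X n y) x).
    by apply/funext => n; rewrite (psd_adj (pV n)) dotC.
  by rewrite (dotC x); exact: cvg_dot.
have nY x : `|Y x| <= `|x|.
  have nVY : (fun n => `|visser X n x| : R) @ \oo --> (`|Y x| : R).
    exact: cvg_norm.
  by apply: (cvgr_to_le nVY); apply: nearW => n; exact: visser_contract.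
exists Y; split.
- split => //.
    by apply: (bop_intro (M := 1)) => [|x]; [exact: is_adjoint_lin aY|rewrite mul1r].
  move=> x; apply: (cvgr_to_ge (cvg_dot (VY x))); apply: nearW => n.
  exact: psd_ge0.
- move=> x; rewrite (le_trans (ler_norm _))// (le_trans (cauchy_schwarz _ _))//.
  by rewrite expr2 ler_wpM2r.
- move=> x; apply: dot_ext => z; rewrite dotZl dotDl (aY (Y x)).
  have VS : (fun n => dot (visser X n.+1 x) z : R) @ \oo --> dot (Y x) z.
    have := cvg_dot (x := z) (VY x).
    by rewrite -(cvg_shiftS (fun n => dot (visser X n x) z : R)).
  apply: (limR_uniq VS).
  have -> : (fun n => dot (visser X n.+1 x) z : R) =
      (fun n => 2^-1 * (dot (X x) z + dot (visser X n x) (visser X n z))).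
    by apply/funext => n; rewrite /= dotZl dotDl (psd_adj (pV n)).
  apply: cvgM; first exact: cvg_cst.
  by apply: cvgD; [exact: cvg_cst|exact: cvg_dot2].
- move=> g bg gX x; apply: dot_ext => z; rewrite (bop_adj bg).
  apply: (limR_uniq (cvg_dot (VY x))).
  have -> : (fun n => dot (visser X n x) (adj g z) : R) =
      (fun n => dot (visser X n (g x)) z).
    apply/funext => n; rewrite -(bop_adj bg); congr dot.
    exact: pcone_commute (visser_pcone n lX) bg.1 gX.
  exact: cvg_dot.
Qed.

(** With [C] a bound of [f], the operator [X = 1 - f / C] lies between 0 and 1, and the fixed point
    [Y] gives [(1 - Y)^2 = 1 - X = f / C]; the root is [C^(1/2) (1 - Y)]. The commutation clause is
    what uniqueness rests on. *)
Lemma sqrt_exists f : psd_op f -> exists s, [/\ psd_op s, s \o s = f &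
  forall g, bounded_op g -> (forall x, g (f x) = f (g x)) ->
    forall x, g (s x) = s (g x)].
Proof.
move=> pf; have [C C0 fC] := bop_bound (psd_bop pf).
pose X x := x - C^-1 *: f x.
have pX : psd_op X.
  split.
  - apply: bop_sub; [exact: bop_id|exact/bop_scale/psd_bop].
  - by apply: is_adjoint_sub => //; exact/is_adjoint_scale/psd_adj.
  - move=> x; rewrite dotBl dotZl subr_ge0 mulrC ler_pdivrMr// dotxx.
    rewrite (le_trans (ler_norm _))// (le_trans (cauchy_schwarz _ _))//.
    by rewrite (_ : _ * C = C * `|x| * `|x|); [rewrite ler_wpM2r|ring].
have X1 y : dot (X y) y <= `|y| ^+ 2.
  rewrite dotBl dotxx dotZl lerBlDr lerDl mulr_ge0 ?invr_ge0 ?(ltW C0)//.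
  exact: psd_ge0.
have [Y [pY Y1 YX Yg]] := visser_fixpoint pX X1.
have C2 : (Num.sqrt C) ^+ 2 = C by rewrite sqr_sqrtr// ltW.
have lY := psd_lin pY.
exists (fun x => Num.sqrt C *: (x - Y x)); split.
- apply: psd_scale; first exact: sqrtr_ge0.
  split.
  + by apply: bop_sub; [exact: bop_id|exact: psd_bop].
  + by apply: is_adjoint_sub => //; exact: psd_adj.
  + by move=> x; rewrite dotBl subr_ge0 dotxx.
- apply/funext => x /=; rewrite (linZ _ _ lY) (linB _ _ lY) -scalerBr scalerA.
  rewrite -expr2 C2; have := YX x.
  move=> /(congr1 (fun z => 2 *: z)); rewrite scalerA divff// scale1r => Y2.
  have -> : x - Y x - (Y x - Y (Y x)) = x - X x.
    apply: dot_ext => z; move: (congr1 (dot^~ z) Y2).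
    by rewrite dotZl dotDl !dotBl => Y2z; lra.
  by rewrite /X opprB addrC subrK scalerA divff ?gt_eqF// scale1r.
- move=> g bg gf x; rewrite (linZ _ _ bg.1) (linB _ _ bg.1); congr (_ *: (_ - _)).
  apply: Yg => // z; rewrite /X (linB _ _ bg.1) (linZ _ _ bg.1).
  by rewrite gf.
Qed.

(** Both operators are compared with the root [s] that commutes with whatever commutes with the
    square. If [h^2 = s^2] and [d = h x - s x], then [h d + s d = 0]; positivity gives
    [h d = s d = 0], and [|d|^2] is the pairing of [x] with [h d - s d]. *)
Lemma sqrt_unique f g : psd_op f -> psd_op g -> f \o f = g \o g -> f = g.
Proof.
move=> pf pg fg; have lf := psd_lin pf; have lg := psd_lin pg.
have ff x : f (f x) = g (g x) by have /(congr1 (fun h => h x)) := fg.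
have [s [ps ss sc]] : exists s, [/\ psd_op s, s \o s = f \o f &
    forall g, bounded_op g -> (forall x, g (f (f x)) = f (f (g x))) ->
    forall x, g (s x) = s (g x)].
  apply: sqrt_exists; have := psd_sandwich (psd_adj pf) (psd_bop pf) (psd_id H).
  by [].
suff key h : psd_op h -> h \o h = s \o s -> h = s.
  by rewrite (key f)// (key g)// ss.
move=> ph hs; have lh := psd_lin ph; have ls := psd_lin ps.
have hh x : h (h x) = s (s x) by have /(congr1 (fun k => k x)) := hs.
have hc x : h (s x) = s (h x).
  apply: sc; first exact: psd_bop.
  have ffs y : f (f y) = s (s y) by have /(congr1 (fun k => k y)) := ss.
  by move=> y; rewrite !ffs -!hh.
apply/funext => x; apply/eqP; rewrite -subr_eq0; apply/eqP.
pose d := h x - s x.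
have hsd : h d + s d = 0.
  by rewrite /d (linB _ _ lh) (linB _ _ ls) hh hc addrA subrK subrr.
have e0 : dot (h d) d + dot (s d) d = 0 by rewrite -dotDl hsd dot0l.
have hd : h d = 0.
  by apply: (psd_null ph); have := psd_ge0 d ph; have := psd_ge0 d ps; lra.
have sd : s d = 0.
  by apply: (psd_null ps); have := psd_ge0 d ph; have := psd_ge0 d ps; lra.
apply: dot_eq0; rewrite -/d {1}/d dotBl (psd_adj ph) (psd_adj ps) hd sd.
by rewrite dot0r subrr.
Qed.

Lemma sqrtopP f : psd_op f -> psd_op (sqrtop f) /\ sqrtop f \o sqrtop f = f.
Proof.
move=> pf; rewrite /sqrtop; case: xgetP => [s _ //|nos].
by have [s [ps ss _]] := sqrt_exists pf; case: (nos s).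
Qed.

Lemma psd_sqr f : psd_op f -> psd_op (f \o f).
Proof.
by move=> pf; exact: psd_sandwich (psd_adj pf) (psd_bop pf) (psd_id H).
Qed.

Lemma sqrtopE f g : psd_op g -> g \o g = f -> sqrtop f = g.
Proof.
move=> pg gf; have /sqrtopP[ps ss] : psd_op f by rewrite -gf; exact: psd_sqr.
by apply: sqrt_unique => //; rewrite ss.
Qed.

Lemma sqrtop_psd f : psd_op f -> psd_op (sqrtop f).
Proof. by move=> /sqrtopP[]. Qed.

Lemma sqrtopK f x : psd_op f -> sqrtop f (sqrtop f x) = f x.
Proof. by move=> /sqrtopP[_ /(congr1 (fun h => h x))]. Qed.

Lemma sqnorm_sqrtop f x : psd_op f -> `|sqrtop f x| ^+ 2 = dot (f x) x.
Proof.
move=> pf; rewrite -dotxx -(psd_adj (sqrtop_psd pf)).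
by rewrite sqrtopK.
Qed.

Lemma null_sqrtop f : psd_op f -> nullsp (sqrtop f) = nullsp f.
Proof.
move=> pf; apply/seteqP; split=> x; rewrite /nullsp /= => x0.
  by rewrite -sqrtopK// x0; apply/lin0/psd_lin/sqrtop_psd.
by apply: dot_eq0; rewrite dotxx sqnorm_sqrtop// x0 dot0l.
Qed.

End SquareRoot.

(** * Orthonormal sequences and dimension *)

(** Recursion on the list of all earlier terms, for constructions in which each term depends on its
    whole past. *)
Lemma greedy_sequence (T : Type) (Q : seq T -> T -> Prop) :
  (forall s, exists x, Q s x) ->
  exists e : nat -> T, forall n, Q [seq e i | i <- iota 0 n] (e n).
Proof.
move=> /choice[F FQ].
pose fix g n := if n is m.+1 then rcons (g m) (F (g m)) else [::].
exists (F \o g) => n.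
suff -> : [seq (F \o g) i | i <- iota 0 n] = g n by exact: FQ.
by elim: n => // n IH; rewrite -addn1 iotaD map_cat IH /= cats1 addn1.
Qed.

Section OrthonormalSequences.
Context (R : realType) (H : hilbertType R).
Implicit Types (e f : nat -> H) (x y : H).

Definition orthonormal_seq e :=
  (forall n, e n = 0 \/ `|e n| = 1) /\ (forall m n, m <> n -> dot (e m) (e n) = 0).

Lemma ocl_closedSubspace (V : closedSubspace H) : ocl V = V.
Proof.
rewrite -{1}(range_sub_val V) -range_ocl; last exact: sub_val_lin.
by rewrite range_sub_val -(closure_id _).1//; exact: cs_closed.
Qed.

Lemma dot_sqr_unit e n x : orthonormal_seq e ->
  dot x (e n) * `|e n| ^+ 2 = dot x (e n).
Proof. by move=> [/(_ n)[->|->] _]; rewrite ?dot0r ?mul0r// expr1n mulr1. Qed.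

Lemma dot_sum_orthonormal e n c k : orthonormal_seq e ->
  dot (\sum_(0 <= i < n) c i *: e i) (e k) = if (k < n)%N then c k * `|e k| ^+ 2 else 0.
Proof.
move=> oe; rewrite dot_suml; have [kn|nk] := ltnP k n.
  rewrite (bigD1_seq k) ?mem_index_iota ?iota_uniq//= big1 ?addr0.
    by rewrite dotZl dotxx.
  by move=> i ik; rewrite dotZl oe.2 ?mulr0//; exact/eqP.
rewrite big_nat big1// => i /andP[_ /leq_trans/(_ nk) ik].
by rewrite dotZl oe.2 ?mulr0//; apply/eqP; rewrite ltn_eqF.
Qed.

Lemma sqnorm_sum_orthonormal e n c : orthonormal_seq e ->
  `|\sum_(0 <= i < n) c i *: e i| ^+ 2 = \sum_(0 <= i < n) c i ^+ 2 * `|e i| ^+ 2.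
Proof.
move=> oe; rewrite -dotxx dot_sumr [LHS]big_nat [RHS]big_nat.
apply: eq_bigr => i /andP[_ iltn].
by rewrite dotZr dot_sum_orthonormal// iltn mulrA expr2.
Qed.

(** Polynomials stand for finitely supported coefficient sequences, so that the span of [e] is the
    range of one linear map, to which [range_ocl] and [isometric_factor] apply. *)
Definition poly_comb e (p : {poly R}) := \sum_(0 <= i < size p) p`_i *: e i.

Lemma poly_comb_widen e (p : {poly R}) n : (size p <= n)%N ->
  poly_comb e p = \sum_(0 <= i < n) p`_i *: e i.
Proof.
move=> pn; rewrite /poly_comb (@big_cat_nat _ _ _ (size p) 0 n)//=.
rewrite [X in _ + X]big_nat [X in _ + X]big1 ?addr0// => i /andP[pi _].
by rewrite nth_default// scale0r.
Qed.

Lemma poly_comb_lin e : linear (poly_comb e).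
Proof.
move=> a p q; pose n := maxn (size (a *: p + q)) (maxn (size p) (size q)).
rewrite !(@poly_comb_widen e _ n) ?leq_max ?leqnn ?orbT//.
rewrite scaler_sumr -big_split; apply: eq_bigr => i _ /=.
by rewrite coefD coefZ scalerDl scalerA.
Qed.

Lemma poly_comb_X e n : poly_comb e 'X^n = e n.
Proof.
rewrite (@poly_comb_widen _ _ n.+1) ?size_polyXn// big_nat_recr//=.
rewrite coefXn eqxx scale1r big_nat big1 ?add0r// => i /andP[_ iltn].
by rewrite coefXn ltn_eqF// scale0r.
Qed.

Lemma orthc_poly_comb e x : orthc (range (poly_comb e)) x <->
  forall n, dot x (e n) = 0.
Proof.
split=> [xe n|xe _ [p _ <-]].
  by apply: xe; exists 'X^n => //; exact: poly_comb_X.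
by rewrite dot_sumr big1// => i _; rewrite dotZr xe mulr0.
Qed.

Lemma bessel e n x : orthonormal_seq e ->
  \sum_(0 <= i < n) dot x (e i) ^+ 2 <= `|x| ^+ 2.
Proof.
move=> oe; rewrite -subr_ge0.
have -> : `|x| ^+ 2 - \sum_(0 <= i < n) dot x (e i) ^+ 2 =
    `|x - \sum_(0 <= i < n) dot x (e i) *: e i| ^+ 2.
  rewrite sqnormB sqnorm_sum_orthonormal// dot_sumr.
  have -> : \sum_(0 <= i < n) dot x (e i) ^+ 2 * `|e i| ^+ 2 =
      \sum_(0 <= i < n) dot x (e i) ^+ 2.
    by apply: eq_bigr => i _; rewrite expr2 -mulrA dot_sqr_unit.
  have -> : \sum_(0 <= i < n) dot x (dot x (e i) *: e i) =
      \sum_(0 <= i < n) dot x (e i) ^+ 2.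
    by apply: eq_bigr => i _; rewrite dotZr.
  by ring.
exact: sqr_ge0.
Qed.

Lemma parseval e x : orthonormal_basis e ->
  series (fun n => dot x (e n) ^+ 2) @ \oo --> `|x| ^+ 2.
Proof.
move=> [e1 e2 e3]; have oe : orthonormal_seq e by [].
have cx : closure (range (poly_comb e)) x.
  rewrite range_ocl; last exact: poly_comb_lin.
  move=> y /orthc_poly_comb ye; have -> : y = 0 by exact: e3.
  exact: dot0r.
apply/cvgrPdist_lt => eps eps0.
have sq0 : 0 < Num.sqrt eps by rewrite sqrtr_gt0.
have [_ [p _ <-] xp] := (closureP _ _).1 cx _ sq0.
exists (size p) => // n /= pn; rewrite ger0_norm ?subr_ge0 ?bessel//.
have : `|x - poly_comb e p| ^+ 2 < eps.
  by rewrite -[ltRHS](sqr_sqrtr (ltW eps0)) ltr_pXn2r ?nnegrE ?(ltW sq0)//.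
(* Among combinations of the first [n] vectors the one with coefficients [dot x (e i)] is closest to
   [x], so the remainder of the series is at most the squared distance to [poly_comb e p]. *)
apply: le_lt_trans; rewrite (poly_comb_widen e pn) sqnormB sqnorm_sum_orthonormal//.
rewrite dot_sumr -addrA lerD2l /series/= mulr_sumr -!sumrN -big_split /=.
apply: ler_sum => i _; rewrite dotZr; have := sqr_ge0 (p`_i - dot x (e i)).
have [->|->] := e1 i; first by rewrite dot0r normr0; nra.
by rewrite expr1n; nra.
Qed.

Lemma orthonormal_isometry e f : orthonormal_seq e -> orthonormal_seq f ->
  (forall n, `|e n| = `|f n|) ->
  exists J : H -> H, [/\ bounded_op J,
    forall x, ocl (range (poly_comb e)) x -> `|J x| = `|x| &
    forall x, ocl (range (poly_comb f)) (J x)].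
Proof.
move=> oe of' ef.
have ePf p : `|poly_comb f p| = `|poly_comb e p|.
  apply/eqP; rewrite -(@eqrXn2 _ 2)//; apply/eqP.
  rewrite !sqnorm_sum_orthonormal//.
  by apply: eq_bigr => i _; rewrite ef.
have [J [_ [bJ _ _ _ [_ _ J1 _ [J2 _]]]]] :=
  isometric_factor (poly_comb_lin e) (poly_comb_lin f) ePf.
by exists J.
Qed.

Lemma orthonormal_lin_indep n (v : 'I_n -> H) : (forall i, `|v i| = 1) ->
  (forall i j, i != j -> dot (v i) (v j) = 0) -> lin_indep v.
Proof.
move=> v1 v0 c /(congr1 (dot^~ (v _))) cv i.
have := cv i; rewrite dot0l dot_suml (bigD1 i)//= big1 => [|j ji].
  by rewrite dotZl dotxx v1 expr1n mulr1 addr0.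
by rewrite dotZl v0 ?mulr0.
Qed.

Lemma dense_orth0 (D : set H) x : dense D -> (forall d, D d -> dot x d = 0) -> x = 0.
Proof.
move=> dD xD; apply/eqP/negP => /negP x0.
have xgt0 : 0 < `|x| by rewrite normr_gt0.
have [d [xd Dd]] : ball x `|x| `&` D !=set0.
  by apply: dD; [exists x; exact: ballxx|exact: ball_open].
move: xd; rewrite -ball_normE /= => xd.
have : `|x| * `|x| <= `|x| * `|x - d|.
  rewrite -expr2 -dotxx -[dot x x]subr0 -(xD d Dd) -dotBr.
  exact: le_trans (ler_norm _) (cauchy_schwarz _ _).
by rewrite ler_pM2l// leNgt xd.
Qed.

Lemma countable_enum (T : pointedType) (D : set T) : countable D ->
  exists d : nat -> T, D `<=` range d.
Proof.
move=> /pcard_leP[f]; exists (fun n => xget point [set x | D x /\ f x = n]).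
move=> x Dx; exists (f x) => //; case: xgetP => [y _ [Dy fyx]|/(_ x) []//].
by apply: (inj (f := f)); rewrite ?inE.
Qed.

(** A countable dense family is projected to [V] and orthonormalized without discarding anything: a
    vector dependent on its predecessors leaves residue zero and becomes a zero term. A vector of
    [V] orthogonal to all terms is orthogonal to the dense family. *)
Lemma gram_schmidt (V : closedSubspace H) : separable H ->
  exists e, [/\ orthonormal_seq e, forall n, cs_set V (e n) &
    forall x, cs_set V x -> (forall n, dot x (e n) = 0) -> x = 0].
Proof.
move=> [D /countable_enum[d Dd] dD].
pose p n := sub_val (oproj V (d n)).
pose res n s := p n - \sum_(z <- s) dot (p n) z *: z.
have [s|e eP] := @greedy_sequence H
  (fun s x => x = `|res (size s) s|^-1 *: res (size s) s).
  by eexists.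
pose r n := p n - \sum_(0 <= i < n) dot (p n) (e i) *: e i.
have {}eP n : e n = `|r n|^-1 *: r n.
  have resE : res n [seq e i | i <- iota 0 n] = r n.
    by rewrite /res big_map /r /index_iota subn0.
  by rewrite {1}eP size_map size_iota resE.
have e1 n : e n = 0 \/ `|e n| = 1.
  rewrite eP; have [->|r0] := eqVneq (r n) 0; [by left; rewrite scaler0|right].
  by rewrite normrZ normfV normr_id mulVf// normr_eq0.
have re n : r n = `|r n| *: e n.
  rewrite eP; have [->|r0] := eqVneq (r n) 0; first by rewrite !scaler0.
  by rewrite scalerA divff ?normr_eq0// scale1r.
have lt m n : (m < n)%N -> dot (e m) (e n) = 0.
  elim/ltn_ind: n m => n IH m mn.
  rewrite (eP n) dotC dotZl; suff -> : dot (r n) (e m) = 0 by rewrite mulr0.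
  rewrite dotBl dot_suml (bigD1_seq m) ?mem_index_iota ?iota_uniq//= big_seq_cond big1.
    rewrite addr0 dotZl dotxx; have [->|->] := e1 m; first by rewrite dot0r mul0r subrr.
    by rewrite expr1n mulr1 subrr.
  move=> i /andP[]; rewrite mem_index_iota => /andP[_ iltn] im.
  rewrite dotZl; have [ilm|mli|/eqP] := ltngtP i m; last by rewrite (negbTE im).
    by rewrite IH ?mulr0.
  by rewrite (dotC (e i)) IH ?mulr0.
exists e; split.
- split => // m n /eqP; rewrite neq_ltn => /orP[|nm]; first exact: lt.
  by rewrite dotC lt.
- have Vl : forall n, cs_set V (p n) by move=> n; exact: sub_val_mem.
  have VZ a x : cs_set V x -> cs_set V (a *: x).
    by move=> Vx; rewrite -[_ *: _]addr0; apply: cs_linear => //; exact: cs_zero.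
  elim/ltn_ind => n IH; rewrite eP; apply: (VZ).
  rewrite /r addrC -scaleN1r; apply: cs_linear => //.
  rewrite big_nat; elim/big_ind: _ => [|x y Vx Vy|i /andP[_ iltn]].
  + exact: cs_zero.
  + by rewrite -[x]scale1r; exact: cs_linear.
  + exact/VZ/IH.
- move=> x Vx xe; apply: (dense_orth0 dD) => z /Dd[n _ <-].
  have -> : dot x (d n) = dot x (p n).
    by rewrite -(oproj_id Vx) dotC -oproj_adj dotC.
  have -> : p n = r n + \sum_(0 <= i < n) dot (p n) (e i) *: e i by rewrite subrK.
  rewrite dotDr re dotZr xe mulr0 add0r dot_sumr big1// => i _.
  by rewrite dotZr xe mulr0.
Qed.

End OrthonormalSequences.

(** * Algebraic dimension and isometric embeddings *)

Section Dimension.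
Context (R : realType).

Lemma subdim_ge (E : lmodType R) (V : set E) n (v : 'I_n -> E) :
  lin_indep v -> (forall i, V (v i)) -> (n%:R%:E <= subdim V)%E.
Proof. by move=> iv Vv; apply: ereal_sup_ubound; exists n => //; exists v. Qed.

Lemma subdim_le (E F : lmodType R) (V : set E) (W : set F) :
  (forall n (v : 'I_n -> E), lin_indep v -> (forall i, V (v i)) ->
     exists w : 'I_n -> F, lin_indep w /\ forall i, W (w i)) ->
  (subdim V <= subdim W)%E.
Proof.
move=> VW; apply: ge_ereal_sup => _ [n [v [iv Vv]] <-].
by have [w [iw Ww]] := VW n v iv Vv; exact: subdim_ge iw Ww.
Qed.

Variable H : hilbertType R.
Implicit Types V L : closedSubspace H.

Lemma cs_sum V (I : Type) (r : seq I) (P : pred I) (c : I -> R) (v : I -> H) :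
  (forall i, P i -> cs_set V (v i)) -> cs_set V (\sum_(i <- r | P i) c i *: v i).
Proof.
move=> Vv; elim/big_rec: _ => [|i x Pi Vx]; first exact: cs_zero.
by apply: cs_linear => //; exact: Vv.
Qed.

(** More independent vectors in [L] than entries of [s] make the matrix of inner products have a
    nonzero left kernel vector; the corresponding combination is orthogonal to [s]. *)
Lemma unit_orthogonal_exists L (s : seq H) : ((size s)%:R%:E < subdim L)%E ->
  exists x, [/\ cs_set L x, `|x| = 1 & forall y, y \in s -> dot x y = 0].
Proof.
move=> /ereal_sup_gt[_ [n [v [iv Lv]] <-]]; rewrite lte_fin ltr_nat => sn.
pose M := \matrix_(i < n, j < size s) dot (v i) (nth 0 s j).
have : kermx M != 0.
  rewrite kermx_eq0 /row_free neq_ltn (leq_ltn_trans _ sn)//.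
  exact: rank_leq_col.
move=> /rowV0Pn[c /sub_kermxP cM c0].
pose x := \sum_(i < n) c 0 i *: v i.
have x0 : x != 0.
  apply: contra c0 => /eqP/iv c0; apply/eqP/rowP => i.
  by rewrite c0 mxE.
have Lx : cs_set L x by exact: cs_sum.
exists (`|x|^-1 *: x); split.
- by rewrite -[_ *: _]addr0; apply: cs_linear => //; exact: cs_zero.
- by rewrite normrZ normfV normr_id mulVf// normr_eq0.
- move=> y ys; rewrite dotZl; suff -> : dot x y = 0 by rewrite mulr0.
  have iys : (index y s < size s)%N by rewrite index_mem.
  have := congr1 (fun N : 'rV_(size s) => N 0 (Ordinal iys)) cM; rewrite !mxE => <-.
  rewrite dot_suml; apply: eq_bigr => i _.
  by rewrite dotZl mxE /= nth_index.
Qed.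

Lemma orthonormal_subdim V (e : nat -> H) k : orthonormal_seq e ->
  (forall n, cs_set V (e n)) ->
  ((count (fun x => x != 0) [seq e i | i <- iota 0 k])%:R%:E <= subdim V)%E.
Proof.
move=> oe Ve; rewrite -size_filter filter_map size_map.
set s := [seq i <- iota 0 k | _]; pose v (i : 'I_(size s)) := e (nth 0%N s i).
have us : uniq s by rewrite filter_uniq// iota_uniq.
apply: (@subdim_ge _ _ _ v) => [|i]; last exact: Ve.
apply: orthonormal_lin_indep => [i|i j ij].
  have : nth 0%N s i \in s by rewrite mem_nth.
  rewrite mem_filter /= => /andP[e0 _].
  by have [/eqP|//] := oe.1 (nth 0%N s i); rewrite (negbTE e0).
apply: oe.2; apply/eqP; rewrite nth_uniq//.
Qed.

(** An orthonormal sequence in [L] is built in step with one of [V], with zeros at the same places.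
    Before each nonzero term the number of earlier nonzero terms is below the dimension of [V],
    hence below that of [L], which leaves room for the next vector; finite and infinite dimensions
    need no separate treatment. *)
Lemma subdim_isometry V L : separable H -> (subdim V <= subdim L)%E ->
  exists J : H -> H, [/\ bounded_op J, forall x, cs_set V x -> `|J x| = `|x| &
    forall x, cs_set L (J x)].
Proof.
move=> sepH VL; have [e [oe Ve eV]] := gram_schmidt V sepH.
pose nz (s : seq H) := count (fun x => x != 0) s.
pose E n := [seq e i | i <- iota 0 n].
have ES n : nz (E n.+1) = (nz (E n) + (e n != 0%R))%N.
  by rewrite /nz /E -addn1 iotaD map_cat count_cat /= addn0.
(* The greedy step must succeed for every list, even one with too many nonzero entries; hence the
   hypothesis on the count, discharged afterwards by induction along the sequence. *)
have [s|f fP] := @greedy_sequence H (fun s x => nz s = nz (E (size s)) ->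
    [/\ cs_set L x, `|x| = `|e (size s)| & forall y, y \in s -> dot x y = 0]).
  have [sE|] := eqVneq (nz s) (nz (E (size s))); last by move=> /eqP ne; exists 0.
  have [e0|e0] := eqVneq (e (size s)) 0.
    exists 0 => _; split=> [||y _]; [exact: cs_zero|by rewrite e0|exact: dot0l].
  have [|x [Lx x1 xs]] := @unit_orthogonal_exists L [seq x <- s | x != 0].
    rewrite size_filter; apply: lt_le_trans VL.
    have := orthonormal_subdim (size s).+1 oe Ve.
    rewrite -/(E _) -/(nz _) ES e0 addn1 -sE; apply: lt_le_trans.
    by rewrite lte_fin ltr_nat.
  exists x => _; split => //.
    by have [/eqP|->] := oe.1 (size s); rewrite ?(negbTE e0).
  move=> y ys; have [->|y0] := eqVneq y 0; first exact: dot0r.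
  by apply: xs; rewrite mem_filter y0.
have {}fP n : [/\ cs_set L (f n), `|f n| = `|e n| &
    forall m, (m < n)%N -> dot (f n) (f m) = 0].
  have nzf : nz [seq f i | i <- iota 0 n] = nz (E n) ->
      [/\ cs_set L (f n), `|f n| = `|e n| &
    forall m, (m < n)%N -> dot (f n) (f m) = 0].
    have := fP n; rewrite size_map size_iota => h /h[? ? fm]; split => // m mn.
    by apply: fm; apply/mapP; exists m; rewrite // mem_iota.
  apply: nzf; elim: n => // n IH; rewrite ES -IH /nz -addn1 iotaD map_cat count_cat.
  rewrite /= addn0 add0n; congr (_ + nat_of_bool _)%N.
  have := fP n; rewrite size_map size_iota => /(_ IH)[_ fe _].
  by rewrite -(normr_eq0 (f n)) fe normr_eq0.
have of' : orthonormal_seq f.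
  split=> [n|m n /eqP].
    have [_ fe _] := fP n; have [e0|e1] := oe.1 n; last by right; rewrite fe.
    by left; apply/eqP; rewrite -normr_eq0 fe e0 normr0.
  rewrite neq_ltn => /orP[mn|nm]; last by have [_ _ ->] := fP m.
  by rewrite dotC; have [_ _ ->] := fP n.
have [n|J [bJ J1 Jf]] := orthonormal_isometry oe of'.
  by have [] := fP n.
have subV (g : nat -> H) (W : closedSubspace H) : (forall n, cs_set W (g n)) ->
    ocl (range (poly_comb g)) `<=` cs_set W.
  move=> Wg; rewrite -[X in _ `<=` X]ocl_closedSubspace.
  apply/orthc_sub/orthc_sub => _ [p _ <-]; exact: cs_sum.
exists J; split => // [x Vx|x]; last first.
  by apply: (subV f) => // n; have [] := fP n.
have [y [z [ey ez xyz]]] := orthc_decomp (range (poly_comb e)) x.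
suff y0 : y = 0 by apply: J1; rewrite xyz y0 add0r.
apply: eV; last exact/orthc_poly_comb.
have -> : y = -1 *: z + x by rewrite xyz scaleN1r addrCA addNr addr0.
by apply: cs_linear => //; exact: (subV e).
Qed.

End Dimension.

(** * Hilbert-Schmidt operators and traces *)

Section HilbertSchmidt.
Context (R : realType) (H : hilbertType R).
Implicit Types (X Y : H -> H) (e f : nat -> H).

Lemma nonneg_series_le (u : nat -> R) (t : R) N : (forall n, 0 <= u n) ->
  series u @ \oo --> t -> series u N <= t.
Proof.
move=> u0 ut; apply: (cvgr_to_ge ut); exists N => // n /= Nn.
exact: (nondecreasing_series (P := predT) (fun n _ _ => u0 n)) Nn.
Qed.

Lemma nonneg_series_cvg (u : nat -> R) (M : R) : (forall n, 0 <= u n) ->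
  (forall N, series u N <= M) -> exists2 t, t <= M & series u @ \oo --> t.
Proof.
move=> u0 uM; have /cvg_ex[t ut] : cvgn (series u).
  apply: nondecreasing_is_cvgn; last by exists M => _ [n _ <-].
  by move=> m n mn; exact: (nondecreasing_series (P := predT) (fun n _ _ => u0 n)) mn.
by exists t => //; apply: (cvgr_to_le ut); exact: nearW.
Qed.

(** Squared Hilbert-Schmidt norm computed in [e]; [hsum_basis] shows that the basis does not
    matter. *)
Definition hsum X e (t : R) := series (fun n => `|X (e n)| ^+ 2) @ \oo --> t.

(** Parseval in [e] expands each [|Y (f m)|^2]; a finite exchange of sums followed by Bessel in [f]
    bounds the result by partial sums for [X], so no double series arises. *)
Lemma hsum_adj_le X Y e f t N : is_adjoint X Y -> orthonormal_basis e ->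
  orthonormal_basis f -> hsum X e t ->
  series (fun m => `|Y (f m)| ^+ 2) N <= t.
Proof.
move=> XY be bf Xet; rewrite /series /=.
have lim : (fun n => \sum_(0 <= m < N) series (fun i => dot (Y (f m)) (e i) ^+ 2) n)
    @ \oo --> \sum_(0 <= m < N) `|Y (f m)| ^+ 2.
  by apply: cvg_big => [|m _]; [exact: add_continuous|exact: parseval].
apply: (cvgr_to_le lim); apply: nearW => n.
rewrite /series /= exchange_big /=; apply: le_trans (nonneg_series_le n _ Xet).
  rewrite /series /=; apply: ler_sum => i _.
  have [f1 f2 _] := bf; have of' : orthonormal_seq f by [].
  apply: le_trans (bessel N (X (e i)) of'); rewrite le_eqVlt; apply/orP; left.
  by apply/eqP/eq_bigr => m _; rewrite XY dotC.
by move=> m; exact: sqr_ge0.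
Qed.

Lemma hsum_adj X Y e f t : is_adjoint X Y -> orthonormal_basis e ->
  orthonormal_basis f -> hsum X e t -> hsum Y f t.
Proof.
move=> XY be bf Xet.
have [||t' t't Yft'] := @nonneg_series_cvg (fun m => `|Y (f m)| ^+ 2) t.
- by move=> n; exact: sqr_ge0.
- by move=> N; exact: hsum_adj_le Xet.
suff -> : t = t' by [].
apply: le_anti; rewrite t't andbT; apply: (cvgr_to_le Xet); apply: nearW => n.
exact: hsum_adj_le (is_adjointC XY) bf be Yft'.
Qed.

Lemma hsum_basis X Y e f t : is_adjoint X Y -> orthonormal_basis e ->
  orthonormal_basis f -> hsum X e t -> hsum X f t.
Proof.
move=> XY be bf He; apply: (hsum_adj (is_adjointC XY) bf bf).
exact: hsum_adj XY be bf He.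
Qed.

Lemma hsum_le X Y e t : (forall x, `|Y x| <= `|X x|) -> hsum X e t ->
  exists2 t', t' <= t & hsum Y e t'.
Proof.
move=> YX Xet; apply: nonneg_series_cvg => [n|N]; first exact: sqr_ge0.
apply: le_trans (nonneg_series_le N _ Xet) => [|n]; last exact: sqr_ge0.
by apply: ler_sum => n _; rewrite ler_pXn2r// nnegrE.
Qed.

Lemma hsum_add X Y e a b : hsum X e a -> hsum Y e b ->
  exists t, hsum (fun x => X x + Y x) e t.
Proof.
move=> Xa Yb; have [||t _ ?] :=
  @nonneg_series_cvg (fun n => `|X (e n) + Y (e n)| ^+ 2) (2 * a + 2 * b).
- by move=> n; exact: sqr_ge0.
- move=> N; apply: (@le_trans _ _ (2 * series (fun n => `|X (e n)| ^+ 2) N +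
    2 * series (fun n => `|Y (e n)| ^+ 2) N)).
    rewrite /series /= !mulr_sumr -big_split /=; apply: ler_sum => n _.
    have := sqr_ge0 `|X (e n) - Y (e n)|; rewrite sqnormB sqnormD; lra.
  by rewrite lerD// ler_pM2l//; apply: nonneg_series_le => // n; exact: sqr_ge0.
by exists t.
Qed.

Lemma series_pair X Y e a b : hsum (fun x => X x + Y x) e a ->
  hsum (fun x => X x - Y x) e b ->
  series (fun n => dot (X (e n)) (Y (e n))) @ \oo --> (a - b) / 4.
Proof.
move=> Ha Hb.
have -> : series (fun n => dot (X (e n)) (Y (e n)) : R) =
   (fun N => (series (fun n => `|X (e n) + Y (e n)| ^+ 2) N -
     series (fun n => `|X (e n) - Y (e n)| ^+ 2) N) / 4).
  apply/funext => N; rewrite /series /= -sumrB mulr_suml.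
  by apply: eq_bigr => n _; rewrite dot_polar.
by apply: cvgM; [exact: cvgB|exact: cvg_cst].
Qed.

(* [tr (Y^* X) = tr (X Y^* )] for Hilbert-Schmidt [X] and [Y]. *)
Lemma trace_pair X X' Y Y' e a b : is_adjoint X X' -> is_adjoint Y Y' ->
  orthonormal_basis e -> hsum X e a -> hsum Y e b ->
  exists t : R, forall f, orthonormal_basis f ->
    series (fun n => dot (X (f n)) (Y (f n))) @ \oo --> t /\
    series (fun n => dot (X' (f n)) (Y' (f n))) @ \oo --> t.
Proof.
move=> aX aY be Xa Yb.
have [p Hp] := hsum_add Xa Yb.
have [m Hm] : exists m, hsum (fun x => X x - Y x) e m.
  apply: (hsum_add (Y := fun x => - Y x) Xa (b := b)).
  by rewrite /hsum; under eq_fun do rewrite normrN.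
(* Polarization reduces both series to the Hilbert-Schmidt norms of [X + Y] and [X - Y], which are
   invariant under change of basis and passage to adjoints. *)
exists ((p - m) / 4) => f bf.
have aD := is_adjoint_add aX aY; have aB := is_adjoint_sub aX aY.
split; apply: series_pair.
- exact: hsum_basis aD be bf Hp.
- exact: hsum_basis aB be bf Hm.
- exact: hsum_adj aD be bf Hp.
- exact: hsum_adj aB be bf Hm.
Qed.

Lemma orthonormal_basis_exists : separable H ->
  exists e : nat -> H, orthonormal_basis e.
Proof.
move=> sH; have [e [[e1 e2] _ e3]] := gram_schmidt (orthcs set0) sH.
by exists e; split => // x xe; apply: e3.
Qed.

Lemma optraceE X (t : R) : separable H -> (forall e, orthonormal_basis e ->
  series (fun n => dot (X (e n)) (e n)) @ \oo --> t) -> optrace X = t.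
Proof.
move=> sH Xt; rewrite /optrace; case: xgetP => [t' _ Xt'|/(_ t)//].
have [e be] := orthonormal_basis_exists sH.
exact: limR_uniq (Xt' e be) (Xt e be).
Qed.

Lemma adj_contract (K L : hilbertType R) (f : K -> L) g : is_adjoint f g ->
  (forall x, `|f x| <= `|x|) -> forall y, `|g y| <= `|y|.
Proof.
move=> fg f1 y; apply: norm_le_dot => // x; rewrite dotC -fg.
rewrite (le_trans (ler_norm _))// (le_trans (cauchy_schwarz _ _))// mulrC.
by rewrite ler_wpM2l.
Qed.

(* With [Q = P^(1/2)], the Hilbert-Schmidt norm of [Q - Q W'] is at most
   [2 (tr P - tr (P W'))], hence vanishes. *)
Lemma trace_equality_case P W W' e (t : R) : psd_op P -> is_adjoint W W' ->
  (forall x, `|W x| <= `|x|) -> orthonormal_basis e ->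
  series (fun n => dot (P (e n)) (e n)) @ \oo --> t ->
  series (fun n => dot (P (W' (e n))) (e n)) @ \oo --> t ->
  forall x, P (W' x) = P x.
Proof.
move=> pP aW W1 be Pt PWt.
pose Q := sqrtop P; have pQ : psd_op Q by exact: sqrtop_psd.
have aQ := psd_adj pQ; have QQ x : Q (Q x) = P x by exact: sqrtopK.
have Qt : hsum Q e t.
  by rewrite /hsum; under eq_fun do rewrite sqnorm_sqrtop//.
have [t' t't WQt'] : exists2 t', t' <= t & hsum (W \o Q) e t'.
  by apply: hsum_le Qt => x /=.
have aWQ : is_adjoint (W \o Q) (Q \o W') by exact: is_adjoint_comp.
have QWt' := hsum_adj aWQ be be WQt'.
have Dt : series (fun n => `|Q (e n) - Q (W' (e n))| ^+ 2) @ \oo --> t - 2 * t + t'.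
  have -> : series (fun n => `|Q (e n) - Q (W' (e n))| ^+ 2) =
    (fun N => series (fun n => `|Q (e n)| ^+ 2) N -
      2 * series (fun n => dot (P (W' (e n))) (e n)) N +
      series (fun n => `|Q (W' (e n))| ^+ 2) N).
    apply/funext => N; rewrite /series /= mulr_sumr -sumrB -big_split /=.
    apply: eq_bigr => n _; rewrite sqnormB -QQ.
    by rewrite (aQ (Q _)) [in RHS]dotC.
  apply: cvgD => //; apply: cvgB => //.
  by apply: cvgM => //; exact: cvg_cst.
(* The nonnegative terms sum to [t' - t], which is not positive, so each of them vanishes. *)
have Qe n : Q (e n) = Q (W' (e n)).
  apply/eqP; rewrite -subr_eq0 -normr_eq0 -sqrf_eq0 eq_le sqr_ge0 andbT.
  have := nonneg_series_le n.+1 (fun n => sqr_ge0 _) Dt.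
  have := nonneg_series_le n (fun n => sqr_ge0 _) Dt.
  have : 0 <= series (fun n => `|Q (e n) - Q (W' (e n))| ^+ 2) n.
    by apply: sumr_ge0 => i _; exact: sqr_ge0.
  rewrite [X in _ -> _ -> X <= _ -> _]/series /= big_nat_recr//=.
  rewrite -[\sum_(0 <= i < n) _]/(series (fun n => `|Q (e n) - Q (W' (e n))| ^+ 2) n).
  move: (series _ n) => s; lra.
have WQ x : W (Q x) = Q x.
  apply/eqP; rewrite -subr_eq0; apply/eqP; have [_ _ e3] := be; apply: e3 => n.
  by rewrite dotBl aW aQ -Qe aQ subrr.
move=> x; rewrite -!QQ; congr Q.
by apply: dot_ext => y; rewrite aQ (is_adjointC aW) WQ aQ.
Qed.

(** For positive [A] the modulus in the definition of trace class is [A] itself, and [dot (A x) x]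
    is [|A^(1/2) x|^2]. *)
Lemma hsum_sqrtop_cov (A : covop H) e : orthonormal_basis e ->
  exists t, hsum (sqrtop A) e t.
Proof.
move=> be; have pA := cov_psd A.
have [_ /(_ e be)] := cov_trace_class A.
rewrite (adjE (psd_adj pA)) (sqrtopE pA erefl) => /cvg_ex[t At].
exists t; rewrite /hsum.
by under eq_fun do rewrite sqnorm_sqrtop//.
Qed.

End HilbertSchmidt.

(** * Optimal pre-pushforwards *)

Section Coupling.
Context (R : realType) (H : hilbertType R) (A B : covop H).
Local Notation sA := (sqrtop A).
Local Notation sB := (sqrtop B).
Local Notation P := (sqrtop (sA \o B \o sA)).

Let pA := cov_psd A.
Let pB := cov_psd B.

Lemma cov_sqrt_psd : psd_op sA.
Proof. exact: sqrtop_psd. Qed.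
Let psA := cov_sqrt_psd.

Lemma gram_psd : psd_op (sA \o B \o sA).
Proof. exact: psd_sandwich (psd_adj psA) (psd_bop psA) pB. Qed.

Lemma gram_sqrt_psd : psd_op P.
Proof. exact/sqrtop_psd/gram_psd. Qed.

Lemma gram_sqrt_norm x : `|P x| = `|sB (sA x)|.
Proof.
apply/eqP; rewrite -(@eqrXn2 _ 2)//; apply/eqP.
by rewrite (sqnorm_sqrtop _ gram_psd) sqnorm_sqrtop//= (psd_adj psA).
Qed.

(* The operators [S = T A^(1/2)] for [T] an optimal pre-pushforward, with
   [S'] the adjoint of [S]. *)
Definition coupling (S S' : H -> H) : Prop :=
  [/\ bounded_op S, is_adjoint S S', forall x, S (S' x) = B x,
      forall x, A x = 0 -> S x = 0 & forall x, sA (S x) = P x].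

Lemma coupling_adj_norm (S S' : H -> H) x :
  is_adjoint S S' -> (forall x, S (S' x) = B x) ->
  `|S' x| ^+ 2 = dot (B x) x.
Proof. by move=> aS SS; rewrite (sqnorm_adj _ (is_adjointC aS)) SS dotC. Qed.

(** Condition (i) alone bounds [S]: it gives [|S' x| = |B^(1/2) x|], so [S'] is bounded, and so is
    its adjoint. *)
Lemma coupling_bop (S S' : H -> H) : is_adjoint S S' ->
  (forall x, S (S' x) = B x) -> bounded_op S.
Proof.
move=> aS SS.
suff bS' : bounded_op S' by exact: is_adjoint_bop (is_adjointC aS) bS'.
have psB := sqrtop_psd pB; have [M M0 BM] := bop_bound (psd_bop psB).
apply: (bop_intro (M := M)) => [|x]; first exact/is_adjoint_lin/is_adjointC.
apply: le_trans (BM x); rewrite -(@ler_pXn2r _ 2) ?nnegrE//.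
by rewrite (coupling_adj_norm _ aS SS) sqnorm_sqrtop.
Qed.

Lemma sqrtop_null x : (A x = 0) <-> (sA x = 0).
Proof. by have /seteqP[h1 h2] := null_sqrtop pA; split; [exact: h2|exact: h1]. Qed.

Lemma optimal_coupling (T : H -> H) : separable H ->
  optimal_pre_pushforward A B T -> coupling (T \o sA) (adj (T \o sA)).
Proof.
move=> sepH [lT [aS SS] tr1 tr2].
set S := T \o sA in aS SS *; set S' := adj S in aS SS *.
have SSx x : S (S' x) = B x by have := congr1 (fun h => h x) SS.
have bS : bounded_op S := coupling_bop aS SSx.
have lsA := psd_lin psA; have asA := psd_adj psA.
have pP := gram_sqrt_psd.
have nullS x : A x = 0 -> S x = 0.
  move=> /sqrtop_null x0; rewrite /S /= x0.
  by have := lT (-1) 0 0; rewrite scaler0 addr0 scaleN1r addNr; apply;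
     exists 0 => //; exact: lin0.
split => //.
have aM : is_adjoint (sA \o S) (S' \o sA) by exact: is_adjoint_comp.
have nMP x : `|S' (sA x)| = `|P x|.
  apply/eqP; rewrite -(@eqrXn2 _ 2)//; apply/eqP.
  by rewrite (coupling_adj_norm _ aS SSx) gram_sqrt_norm sqnorm_sqrtop.
have lM' : linear (S' \o sA) := is_adjoint_lin (is_adjointC aM).
have [W [V [bW bV aWV WP [VM _ _ _ [_ V1]]]]] :=
  isometric_factor (psd_lin pP) lM' nMP.
have W1 := adj_contract (is_adjointC aWV) V1.
have MPV x : sA (S x) = P (V x).
  apply: dot_ext => y; rewrite (psd_adj pP) (is_adjointC aWV) WP asA aS.
  by [].
have [e be] := orthonormal_basis_exists sepH.
have [a Aa] := hsum_sqrtop_cov A be.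
have [b Bb] := hsum_sqrtop_cov B be.
have S'b : hsum S' e b.
  rewrite /hsum; under eq_fun do rewrite (coupling_adj_norm _ aS SSx) -sqnorm_sqrtop//.
  exact: Bb.
have Sb := hsum_adj (is_adjointC aS) be be S'b.
have [t1 Mt] := trace_pair aS asA be Sb Aa.
have optM : optrace (sA \o T \o sA) = t1.
  apply: optraceE => // f bf; have [Mf _] := Mt f bf.
  by under eq_fun do rewrite /= asA.
(* From [P = V S' A^(1/2)] the diagonal sums of [P] are pairings of the Hilbert-Schmidt operators
   [A^(1/2)] and [S W]; hence they converge, in every basis, to one value. *)
have [b' _ VSb] := hsum_le (Y := V \o S') (fun x => V1 _) S'b.
have aSW : is_adjoint (S \o W) (V \o S') by exact: is_adjoint_comp.
have SWb := hsum_adj (is_adjointC aSW) be be VSb.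
have [t2 Pt] := trace_pair asA aSW be Aa SWb.
have Ptr f : orthonormal_basis f ->
    series (fun n => dot (P (f n)) (f n)) @ \oo --> t2.
  move=> bf; have [Pf _] := Pt f bf.
  suff -> : (fun n => dot (P (f n)) (f n) : R) =
      (fun n => dot (sA (f n)) ((S \o W) (f n))) by [].
  by apply/funext => n; rewrite -VM (is_adjointC aWV) (is_adjointC aS).
have optP : optrace P = t2 by exact: optraceE.
have t12 : t1 = t2 by rewrite -optM tr1 tr2 optP.
move=> x; rewrite MPV; apply: (trace_equality_case pP aWV W1 be (Ptr e be)).
rewrite -t12; have [Me _] := Mt e be.
suff -> : (fun n => dot (P (V (e n))) (e n) : R) =
    (fun n => dot (S (e n)) (sA (e n))) by [].
by apply/funext => n; rewrite -MPV asA.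
Qed.

Lemma coupling_optimal S S' : separable H -> coupling S S' -> leadsto A B.
Proof.
move=> sepH [bS aS SS nullS sAS].
have lsA := psd_lin psA; have asA := psd_adj psA.
(* [S] is applied to an arbitrary preimage under [A^(1/2)]; the choice is immaterial because [S]
   vanishes on [N(A)]. Off the range the value is the junk [S 0]. *)
pose T y := S (xget 0 [set x | sA x = y]).
have TS : T \o sA = S.
  apply/funext => x; rewrite /T /=; case: xgetP => [x' _ /= xx'|/(_ x) []//].
  apply/eqP; rewrite -subr_eq0 -(linB _ _ bS.1) nullS//.
  by apply/sqrtop_null; rewrite (linB _ _ lsA) xx' subrr.
have TSx x : T (sA x) = S x by have := congr1 (fun h => h x) TS.
have [e be] := orthonormal_basis_exists sepH.
have [a Aa] := hsum_sqrtop_cov A be.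
have [b Bb] := hsum_sqrtop_cov B be.
have S'b : hsum S' e b.
  rewrite /hsum; under eq_fun do rewrite (coupling_adj_norm _ aS SS) -sqnorm_sqrtop//.
  exact: Bb.
have Sb := hsum_adj (is_adjointC aS) be be S'b.
have [t tP] := trace_pair aS asA be Sb Aa.
have tr1 : optrace (sA \o T \o sA) = t.
  apply: optraceE => // f bf; have [Mf _] := tP f bf.
  by under eq_fun do rewrite /= TSx asA.
have tr2 : optrace (T \o A) = t.
  apply: optraceE => // f bf; have [_ Mf] := tP f bf.
  by under eq_fun do rewrite /= -(sqrtopK _ pA) TSx aS dotC.
exists T; split.
- move=> c _ _ [x _ <-] [y _ <-].
  by rewrite -lsA !TSx bS.1.
- by rewrite TS (adjE aS); split => //; apply/funext => x /=; rewrite SS.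
- by rewrite tr1 tr2.
- rewrite tr2 -tr1; congr optrace; apply/funext => x /=.
  by rewrite TSx sAS.
Qed.

End Coupling.

(** * The dimension criterion *)

Section Criterion.
Context (R : realType) (H : hilbertType R) (A B : covop H).
Local Notation sA := (sqrtop A).
Local Notation sB := (sqrtop B).
Local Notation P := (sqrtop (sA \o B \o sA)).

Let pA := cov_psd A.
Let pB := cov_psd B.
Let psA := cov_sqrt_psd A.
Let psB := cov_sqrt_psd B.
Let pP := gram_sqrt_psd A B.

Lemma cov_H1E : cs_set (cov_H1 A) = orthc (nullsp A).
Proof.
by rewrite (orthc_null (psd_adj pA)) -range_ocl//; exact: psd_lin.
Qed.

Lemma orthc_cov_H1 : orthc (cov_H1 A) = nullsp A.
Proof. by rewrite cov_H1E; exact: (ocl_closedSubspace (cov_H2 A)). Qed.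

Lemma gram_null x : P x = 0 <-> sB (sA x) = 0.
Proof.
split=> /eqP; rewrite -normr_eq0; first by rewrite gram_sqrt_norm normr_eq0 => /eqP.
by rewrite -gram_sqrt_norm normr_eq0 => /eqP.
Qed.

Lemma coupling_adj_H1 S S' x : coupling A B S S' -> cs_set (cov_H1 A) (S' x).
Proof.
move=> [_ aS _ nullS _]; rewrite cov_H1E => y Ay.
by rewrite (is_adjointC aS) nullS ?dot0r.
Qed.

(** Equal norms of [S'] and [B^(1/2)] give [S = B^(1/2) V]. If [z] is the component of [u] in the
    closed range of [B^(1/2)], then [W z] is a preimage of [B^(1/2) u], and it lies in the closed
    range of [S'], hence in [H1]. *)
Lemma coupling_range S S' v : coupling A B S S' -> range sB v ->
  exists2 w, cs_set (cov_H1 A) w & S w = v.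
Proof.
move=> cS [u _ <-]; have [bS aS SS nullS _] := cS.
have nS' x : `|S' x| = `|sB x|.
  apply/eqP; rewrite -(@eqrXn2 _ 2)//; apply/eqP.
  by rewrite (coupling_adj_norm _ aS SS) sqnorm_sqrtop.
have [W [V [bW bV aWV WsB [_ VW _ _ [WS' _]]]]] :=
  isometric_factor (psd_lin psB) (is_adjoint_lin (is_adjointC aS)) nS'.
have SV x : S x = sB (V x).
  by apply: dot_ext => y; rewrite aS (psd_adj psB) (is_adjointC aWV) WsB.
have [y [z [yB zB uyz]]] := orthc_decomp (range sB) u.
exists (W z); last first.
  rewrite SV VW// uyz (linD _ _ (psd_lin psB)).
  by move: yB; rewrite -(null_adj (psd_adj psB)) => ->; rewrite add0r.
rewrite -(ocl_closedSubspace (cov_H1 A)).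
apply: (orthc_sub (orthc_sub _)) (WS' z) => _ [x _ <-].
exact: coupling_adj_H1 cS.
Qed.

(** Preimages under [S] of independent vectors are independent, and a preimage [w] in [H1] of a
    vector [v] of [N(A)] satisfies [P w = A^(1/2) S w = A^(1/2) v = 0]. *)
Lemma coupling_subdim S S' : coupling A B S S' ->
  (subdim (range sB `&` cov_H2 A) <= subdim (nullsp (sB \o sA) `&` cov_H1 A))%E.
Proof.
move=> cS; apply: subdim_le => n v iv vB.
have /choice[w wP] : forall i, exists w, cs_set (cov_H1 A) w /\ S w = v i.
  by move=> i; have [w w1 Sw] := coupling_range cS (vB i).1; exists w.
have [bS _ _ _ sAS] := cS.
exists w; split=> [c cw|i].
  apply: iv; rewrite -[RHS](lin0 bS.1) -[in RHS]cw (lin_sum _ _ _ bS.1).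
  by apply: eq_bigr => i _; rewrite (linZ _ _ bS.1) (wP i).2.
split; last exact: (wP i).1.
apply/gram_null; rewrite -sAS (wP i).2; apply/sqrtop_null.
exact: (vB i).2.
Qed.

(** [K] is the part of the closed range of [B^(1/2)] orthogonal to the range of [B^(1/2) A^(1/2)],
    and [L] is the space into which it must embed. Written as orthogonal complements, both are
    closed subspaces by construction. *)
Let K := orthcs (nullsp sB `|` range (sB \o sA)).
Let L := orthcs (nullsp A `|` range (sA \o sB)).

Let K_null y : cs_set K y -> orthc (nullsp sB) y.
Proof. by move=> Ky z Bz; apply: Ky; left. Qed.

Let K_range y : cs_set K y -> orthc (range (sB \o sA)) y.
Proof. by move=> Ky z Bz; apply: Ky; right. Qed.

Let adjAB : is_adjoint (sA \o sB) (sB \o sA).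
Proof. exact: is_adjoint_comp (psd_adj psB) (psd_adj psA). Qed.

Let LE : cs_set L = nullsp (sB \o sA) `&` cov_H1 A.
Proof.
rewrite cov_H1E (null_adj (is_adjointC adjAB)); apply/seteqP; split.
  by move=> x Lx; split=> y Ay; apply: Lx; [right|left].
by move=> x [x1 x2] y [|]; [exact: x2|exact: x1].
Qed.

(** [B^(1/2)] is injective on [K], which is orthogonal to its null space, and maps [K] into [N(A)],
    because the complement of the range of [B^(1/2) A^(1/2)] is the null space of the adjoint
    [A^(1/2) B^(1/2)]. *)
Let subdimK : (subdim K <= subdim (range sB `&` cov_H2 A))%E.
Proof.
apply: subdim_le => n v iv vK; exists (sB \o v); split.
  move=> c cv; apply: iv; pose x := \sum_(i < n) c i *: v i.
  have Kx : cs_set K x by apply: cs_sum => i _; exact: vK.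
  have sBx : sB x = 0.
    rewrite (lin_sum _ _ _ (psd_lin psB)) -[RHS]cv; apply: eq_bigr => i _.
    by rewrite (linZ _ _ (psd_lin psB)).
  by apply: (orthc_cap0 (S := nullsp sB)); [exact: K_null|exact: sub_ocl].
move=> i; split; first by exists (v i).
apply/sqrtop_null; have : nullsp (sA \o sB) (v i); last by [].
by rewrite (null_adj adjAB); exact: K_range.
Qed.

(* [S'] sends [sB (sA x)] to [P x], as the trace condition prescribes, and the
   remaining part [K] of the closed range of [sB] isometrically into [L]. *)
Lemma subdim_coupling : separable H ->
  (subdim (range sB `&` cov_H2 A) <= subdim (nullsp (sB \o sA) `&` cov_H1 A))%E ->
  exists S S', coupling A B S S'.
Proof.
move=> sepH dimle.
have [|J [bJ J1 JL]] := @subdim_isometry _ _ K L sepH.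
  by rewrite LE; exact: le_trans subdimK dimle.
have [[lsB lsA] lP] := (psd_lin psB, psd_lin psA, psd_lin pP).
have lBA : linear (sB \o sA) by exact: lin_comp.
have [W [V [bW bV aWV WsB [_ _ W1 VR [WR _]]]]] :=
  isometric_factor lBA lP (gram_sqrt_norm A B).
pose k x := sub_val (oproj K x).
have bk : bounded_op k by apply: bop_comp; [exact: oproj_bop|exact: sub_val_bop].
pose S' x := W (sB x) + J (k (sB x)).
have bS' : bounded_op S'.
  apply: bop_add; first by apply: bop_comp => //; exact: psd_bop.
  apply: bop_comp => //; apply: bop_comp => //; exact: psd_bop.
have W0 z : orthc (range (sB \o sA)) z -> W z = 0.
  by move=> zR; apply: dot_ext => y; rewrite aWV dot0l dotC VR.
(* Makes the two summands of [S'] orthogonal: [W] takes values in the closed range of [P], while [L]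
   is contained in [N(P)]. *)
have PJ x : orthc (range P) (J x).
  rewrite -(null_adj (psd_adj pP)); apply/gram_null.
  by have : cs_set L (J x) by []; rewrite LE => -[].
have nS' x : `|S' x| = `|sB x|.
  set z := sB x; have zN : orthc (nullsp sB) z.
    by move=> y By; rewrite (psd_adj psB) By dot0r.
  have kK : cs_set K (k z) by exact: sub_val_mem.
  have zk : orthc K (z - k z) by exact: oproj_orthc.
  (* A vector [y] orthogonal to this range splits into a part in [N(B^(1/2))] and a part that falls
     in [K]; [z - k z] is orthogonal to both. *)
  have z1 : ocl (range (sB \o sA)) (z - k z).
    move=> y yR; have [a [b [aN bN yab]]] := orthc_decomp (orthc (nullsp sB)) y.
    have {}aN : nullsp sB a.
      by move: aN; rewrite -/(ocl _) (ocl_closedSubspace (clnull (psd_bop psB))).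
    have {}bN : orthc (nullsp sB) b by rewrite -orthc_ocl.
    have bK : cs_set K b.
      move=> t [Bt|[t' _ <-]]; first exact: bN.
      have -> : b = y - a by rewrite yab addrC addKr.
      rewrite dotBl yR; last by exists t'.
      by rewrite /= -(psd_adj psB) aN dot0l subrr.
    rewrite yab dotDr (zk b bK) addr0 dotBl zN// (K_null kK)//.
    by rewrite subrr.
  apply/eqP; rewrite -(@eqrXn2 _ 2)//; apply/eqP.
  have -> : S' x = W (z - k z) + J (k z).
    by rewrite /S' -/z (linB _ _ bW.1) (W0 _ (K_range kK)) subr0.
  rewrite sqnormD W1// J1// -[z in RHS](subrK (k z)) [RHS]sqnormD (zk _ kK).
  by rewrite (WR (z - k z) _ (PJ _)).
have aS := bop_adj bS'.
exists (adj S'), S'; split.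
- exact: is_adjoint_bop aS bS'.
- exact: is_adjointC.
- move=> x; apply: dot_ext => y; rewrite (is_adjointC aS).
  rewrite (isometric_polar lsB bS'.1 nS') (psd_adj psB) sqrtopK//.
  by rewrite (psd_adj pB).
- move=> x Ax; apply: dot_ext => y; rewrite (is_adjointC aS) dot0l dotDr.
  have xP : orthc (range P) x.
    rewrite -(null_adj (psd_adj pP)); apply/gram_null.
    by have /sqrtop_null -> := Ax; exact: lin0.
  rewrite [dot x _]dotC (WR _ x xP) add0r dotC.
  have : cs_set L (J (k (sB y))) by []; apply; by left.
- move=> x; apply: dot_ext => y.
  rewrite (psd_adj psA) (is_adjointC aS) (psd_adj pP) -WsB /S' /k oproj_eq0.
    by rewrite (lin0 bJ.1) addr0.
  by move=> t Kt; rewrite dotC K_range//; exists y.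
Qed.

End Criterion.

(** * Pseudoinverses and the block form of [T] *)

Section Pseudoinverse.
Context (R : realType) (H K : hilbertType R).

Lemma pinvK (f : H -> K) x : linear f -> orthc (nullsp f) x -> Defs.pinv f (f x) = x.
Proof.
move=> lf xN; rewrite /Defs.pinv; case: xgetP => [y _ [yN [z zR xyz]]|nox]; last first.
  exfalso; apply: (nox x); split=> //; exists 0; first exact: orthc0.
  by rewrite addr0.
have zE : z = f (x - y) by rewrite linB// xyz addrC addKr.
have z0 : z = 0 by apply: dot_eq0; rewrite {2}zE; apply: zR; exists (x - y).
apply/eqP; rewrite eq_sym -subr_eq0; apply/eqP.
apply: (orthc_cap0 (S := nullsp f)); first exact: orthcB.
by apply: sub_ocl; rewrite /nullsp /= -zE.
Qed.

Lemma isometric_factor_initial (E : lmodType R) (P : E -> H) (W : H -> K) :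
  linear W -> (forall z, ocl (range P) z -> `|W z| = `|z|) ->
  (forall z, orthc (range P) z -> W z = 0) -> initial_space W = ocl (range P).
Proof.
move=> lW W1 W0; apply/seteqP; split=> [|z zP y Wy].
  by apply: orthc_sub => z zP; exact: W0.
have [a [b [aP bP yab]]] := orthc_decomp (range P) y.
have b0 : b = 0.
  apply/eqP; rewrite -normr_eq0 -W1//.
  by have : W y = 0 := Wy; rewrite yab linD// (W0 a aP) add0r => ->; rewrite normr0.
by rewrite yab b0 addr0 zP.
Qed.

End Pseudoinverse.

Section Form.
Context (R : realType) (H : hilbertType R) (A B : covop H).
Local Notation sA := (sqrtop A).
Local Notation P := (sqrtop (sA \o B \o sA)).
Local Notation H1 := (cov_H1 A).
Local Notation H2 := (cov_H2 A).
Local Notation sA1 := (sqrtop (A11 A)).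
Local Notation b1 := (sqrtop (B11 A B)).
Local Notation P1 := (sqrtop (pushforward_gram A B)).

Let pA := cov_psd A.
Let pB := cov_psd B.
Let psA := cov_sqrt_psd A.
Let pP := gram_sqrt_psd A B.

Lemma psd_range_H1 (f : H -> H) x : psd_op f -> (forall y, A y = 0 -> f y = 0) ->
  cs_set H1 (f x).
Proof.
by move=> pf Af; rewrite cov_H1E => y Ay; rewrite (psd_adj pf) Af// dot0r.
Qed.

Lemma sqrtop_H1 x : cs_set H1 (sA x).
Proof. by apply: psd_range_H1 => // y /sqrtop_null. Qed.

Lemma gram_sqrt_H1 x : cs_set H1 (P x).
Proof.
apply: psd_range_H1 => // y /sqrtop_null Ay; apply/gram_null.
by rewrite Ay; exact/lin0/psd_lin/cov_sqrt_psd.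
Qed.

Lemma block_psd (f : H -> H) (V : closedSubspace H) : psd_op f -> psd_op (block V V f).
Proof.
exact: psd_sandwich (is_adjointC (@oproj_adj R H V)) (@sub_val_bop R H V).
Qed.

(** Compression to [V] does not commute with squaring in general; it does here because [g] takes its
    values in [V]. *)
Lemma block_sqrt (f g : H -> H) (V : closedSubspace H) : psd_op g ->
  (forall x, cs_set V (g x)) ->
  (forall v : subsp V, g (g (sub_val v)) = f (sub_val v)) ->
  sqrtop (block V V f) = block V V g.
Proof.
move=> pg gV gg; apply: sqrtopE; first exact: block_psd.
by apply/funext => v; rewrite /block /= oproj_id// gg.
Qed.

Lemma sub_val_sqrtop_A11 v : sub_val (sA1 v) = sA (sub_val v).
Proof.
rewrite /A11 (@block_sqrt _ sA)//.
- by rewrite /block /= oproj_id//; exact: sqrtop_H1.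
- exact: sqrtop_H1.
- by move=> w; exact: sqrtopK.
Qed.

Lemma A11_sqrt_psd : psd_op sA1.
Proof. exact/sqrtop_psd/block_psd. Qed.
Let psA1 := A11_sqrt_psd.

Lemma B11_psd : psd_op (B11 A B). Proof. exact: block_psd. Qed.

Lemma sqrtop_oproj_H1 x : sA (sub_val (oproj H1 x)) = sA x.
Proof.
apply/eqP; rewrite eq_sym -subr_eq0 -(linB _ _ (psd_lin psA)); apply/eqP/sqrtop_null.
by have := oproj_orthc (V := H1) x; rewrite orthc_cov_H1.
Qed.

Lemma pushforward_gramE : pushforward_gram A B = block H1 H1 (sA \o B \o sA).
Proof.
apply/funext => v; apply: sub_val_inj.
rewrite [LHS](sub_val_sqrtop_A11 (B11 A B (sA1 v))) /B11 /block /=.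
rewrite sub_val_sqrtop_A11 [RHS]oproj_id; last exact: sqrtop_H1.
by rewrite sqrtop_oproj_H1.
Qed.

Lemma sub_val_sqrtop_gram v : sub_val (P1 v) = P (sub_val v).
Proof.
rewrite pushforward_gramE (@block_sqrt _ P)//.
- by rewrite /block /= oproj_id//; exact: gram_sqrt_H1.
- exact: gram_sqrt_H1.
- by move=> w; rewrite sqrtopK//; exact: gram_psd.
Qed.

Lemma pushforward_gram_sqrt_psd : psd_op P1.
Proof. by apply: sqrtop_psd; rewrite pushforward_gramE; exact/block_psd/gram_psd. Qed.
Let pP1 := pushforward_gram_sqrt_psd.

Lemma A11_sqrt_null v : sA1 v = 0 -> v = 0.
Proof.
move=> /(congr1 (@sub_val _ _ _)); rewrite sub_val_sqrtop_A11 => /sqrtop_null Av.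
apply: sub_val_inj; apply: (orthc_cap0 (S := nullsp A)); last exact: sub_ocl.
by rewrite -cov_H1E; exact: sub_val_mem.
Qed.

Lemma pinv_A11_sqrt v : Defs.pinv sA1 (sA1 v) = v.
Proof.
apply: pinvK; first exact: psd_lin.
by move=> y /A11_sqrt_null ->; rewrite dot0r.
Qed.

Lemma oproj_H1_H2 x : x = sub_val (oproj H1 x) + sub_val (oproj H2 x).
Proof.
have xH2 : cs_set H2 (x - sub_val (oproj H1 x)).
  by have := oproj_orthc (V := H1) x; rewrite orthc_cov_H1.
have H120 : oproj H2 (sub_val (oproj H1 x)) = 0.
  by apply: oproj_eq0; have := sub_val_mem (oproj H1 x); rewrite cov_H1E.
have -> : oproj H2 x = oproj H2 (x - sub_val (oproj H1 x)).
  by rewrite (linB _ _ (@oproj_lin _ _ H2)) H120 subr0.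
by rewrite (oproj_id xH2) addrC subrK.
Qed.

Lemma sqrt_gram_null : nullsp P1 = nullsp (b1 \o sA1).
Proof.
suff nE v : `|P1 v| = `|b1 (sA1 v)|.
  apply/seteqP; split=> v /eqP; rewrite /nullsp /= -normr_eq0.
    by rewrite nE normr_eq0 => /eqP.
  by rewrite -nE normr_eq0 => /eqP.
apply/eqP; rewrite -(@eqrXn2 _ 2)//; apply/eqP.
rewrite !sqnorm_sqrtop; first 1 last.
- exact: B11_psd.
- by rewrite pushforward_gramE; exact/block_psd/gram_psd.
by rewrite /= (psd_adj psA1).
Qed.

Section CouplingBlocks.
Context (S S' : H -> H).
Hypothesis cS : coupling A B S S'.

Let bS : bounded_op S. Proof. by case: cS. Qed.
Let aS : is_adjoint S S'. Proof. by case: cS. Qed.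
Let SS x : S (S' x) = B x. Proof. by case: cS. Qed.
Let sAS x : sA (S x) = P x. Proof. by case: cS. Qed.
Let S'H1 x : cs_set H1 (S' x). Proof. exact: coupling_adj_H1 cS. Qed.

(** [X1] and [X2] are all the blocks of [S'], since its values lie in [H1]; the primed blocks are
    their adjoints, taken from [S]. *)
Let X1 := block H1 H1 S'.
Let X1' := block H1 H1 S.
Let X2 := block H1 H2 S'.
Let X2' := block H2 H1 S.

Let aX1 : is_adjoint X1 X1'.
Proof.
apply: is_adjoint_comp (@oproj_adj _ _ H1); apply: is_adjoint_comp (is_adjointC aS).
exact/is_adjointC/oproj_adj.
Qed.

Let aX2 : is_adjoint X2 X2'.
Proof.
apply: is_adjoint_comp (@oproj_adj _ _ H1); apply: is_adjoint_comp (is_adjointC aS).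
exact/is_adjointC/oproj_adj.
Qed.

Let bS' : bounded_op S'. Proof. exact: is_adjoint_bop aS bS. Qed.

Let bX2 : bounded_op X2.
Proof.
apply: bop_comp (@oproj_bop _ _ H1); apply: bop_comp bS'; exact: sub_val_bop.
Qed.

Let lX1 : linear X1. Proof. exact: is_adjoint_lin aX1. Qed.
Let lX2' : linear X2'. Proof. exact/is_adjoint_lin/is_adjointC/aX2. Qed.


Let sAX1 v : sA1 (X1' v) = P1 v.
Proof.
apply: sub_val_inj; rewrite sub_val_sqrtop_gram sub_val_sqrtop_A11.
by rewrite /X1' /block /= sqrtop_oproj_H1.
Qed.

Let P1X2 y : P1 (X2 y) = sA1 (B12 A B y).
Proof.
apply: sub_val_inj; rewrite sub_val_sqrtop_gram sub_val_sqrtop_A11.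
by rewrite /X2 /B12 /block /= sqrtop_oproj_H1 oproj_id// -sAS SS.
Qed.

Let X1X1 v : X1' (X1 v) = B11 A B v.
Proof. by rewrite /X1 /X1' /block /= oproj_id// SS. Qed.

Let X1X2 v : X1' (X2 v) = B12 A B v.
Proof. by rewrite /X2 /X1' /block /= oproj_id// SS. Qed.

Let X2X2 v : X2' (X2 v) = B22 A B v.
Proof. by rewrite /X2 /X2' /block /= oproj_id// SS. Qed.

Let null_P1 : nullsp P1 = orthc (range X1).
Proof.
rewrite -(null_adj (is_adjointC aX1)); apply/seteqP; split=> v; rewrite /nullsp /=.
  by rewrite -sAX1 => /A11_sqrt_null.
by rewrite -sAX1 => ->; exact/lin0/psd_lin/psA1.
Qed.

Let N := clnull (psd_bop pP1).
Let D y := sub_val (oproj N (X2 y)).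
Let D' v := X2' (sub_val (oproj N v)).

Let aD : is_adjoint D D'.
Proof.
move=> y v; rewrite -aX2 /D (is_adjointC (@oproj_adj _ _ N)).
by rewrite oproj_adj.
Qed.

Let bD : bounded_op D.
Proof.
by apply: bop_comp (@sub_val_bop _ _ N); apply: bop_comp bX2 (@oproj_bop _ _ N).
Qed.

Let D'D y : D' (D y) = X2' (D y).
Proof. by rewrite /D' /D oprojK. Qed.

Let X2D_orth y : orthc (nullsp P1) (X2 y - D y).
Proof. exact: (oproj_orthc (V := N)). Qed.

(** [X1] and [B11^(1/2)] have equal norms, so [X1' = B11^(1/2) V] and the operator [C] in the Schur
    complement is [V X2]. As [W V] is the identity on the closed range of [X1], which is the
    complement of [N(P1)], and [V] kills [D y], the term [C^* C] equals [X2' (X2 - D)]. Subtracting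
    it from [B22 = X2' X2] leaves [X2' D = D' D]. *)
Lemma schur_coupling y : schur A B y = D' (D y).
Proof.
have nX1 v : `|X1 v| = `|b1 v|.
  apply/eqP; rewrite -(@eqrXn2 _ 2)//; apply/eqP.
  rewrite sqnorm_sqrtop; last exact: B11_psd.
  by rewrite (sqnorm_adj _ aX1) X1X1 dotC.
have pb1 : psd_op b1 by exact/sqrtop_psd/B11_psd.
have [W [V [bW bV aWV Wb [Vb VW _ VR [WR _]]]]] :=
  isometric_factor (psd_lin pb1) lX1 nX1.
have X1'E v : X1' v = b1 (V v).
  by apply: dot_ext => z; rewrite (is_adjointC aX1) (psd_adj pb1) (is_adjointC aWV) Wb.
have CE : Defs.pinv b1 \o B12 A B = V \o X2.
  apply/funext => v /=; rewrite -X1X2 X1'E pinvK//; first exact: psd_lin.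
  by rewrite (orthc_null (psd_adj pb1)); exact: VR.
have aC : is_adjoint (V \o X2) (X2' \o W).
  exact: is_adjoint_comp aX2 (is_adjointC aWV).
rewrite /schur CE (adjE aC) -X2X2 D'D /= -(linB _ _ lX2'); congr X2'.
have VD : V (D y) = 0.
  have DN : orthc (range X1) (D y)
    by rewrite -null_P1; exact: (sub_val_mem (oproj N (X2 y))).
  have : orthc (range b1) (V (D y)).
    by move=> _ [x _ <-]; rewrite (is_adjointC aWV) Wb DN//; exists x.
  by move=> VD; exact: orthc_cap0 VD (VR _).
have WV a : ocl (range X1) a -> W (V a) = a.
  move=> aX; apply/eqP; rewrite -subr_eq0; apply/eqP.
  apply: (orthc_cap0 (S := range X1)); last exact: (orthcB (WR _) aX).
  move=> _ [x _ <-]; rewrite dotBl aWV (is_adjointC aWV) Vb Wb.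
  by rewrite subrr.
have -> : V (X2 y) = V (X2 y - D y) by rewrite (linB _ _ bV.1) VD subr0.
rewrite WV; first by rewrite opprB addrC subrK.
by rewrite /ocl -null_P1.
Qed.

Lemma coupling_form : exists U12 : subsp H2 -> subsp H1,
  [/\ partial_isometry U12,
      initial_space U12 = closure (range (schur A B)),
      range U12 `<=` nullsp (b1 \o sA1) &
      forall v : subsp H1, S (sub_val v) =
        sub_val (pushforward1 A B (sA1 v)) + sub_val (pushforward2 A B U12 (sA1 v))].
Proof.
have schurE : schur A B = D' \o D by apply/funext => y; exact: schur_coupling.
have psch : psd_op (schur A B) by rewrite schurE; exact: psd_sandwich aD bD (psd_id _).
have pss := sqrtop_psd psch.
have nD y : `|D y| = `|sqrtop (schur A B) y|.
  apply/eqP; rewrite -(@eqrXn2 _ 2)//; apply/eqP.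
  by rewrite sqnorm_sqrtop// schur_coupling (sqnorm_adj _ aD) dotC.
have [U [V [bU bV aUV UD [_ _ U1 VR [UR _]]]]] :=
  isometric_factor (psd_lin pss) bD.1 nD.
have U0 z : orthc (range (sqrtop (schur A B))) z -> U z = 0.
  by move=> zR; apply: dot_ext => y; rewrite aUV dot0l dotC VR.
have initU := isometric_factor_initial bU.1 U1 U0.
exists U; split.
- by split => // x; rewrite initU; exact: U1.
(* The Schur complement and its square root have the same null space, hence the same closed
   range. *)
- rewrite initU range_ocl; last exact: psd_lin.
  by rewrite -(orthc_null (psd_adj pss)) -(orthc_null (psd_adj psch)) null_sqrtop.
- rewrite -sqrt_gram_null => _ [z _ <-].
  have : ocl (range D) `<=` nullsp P1.
    rewrite -[X in _ `<=` X](ocl_closedSubspace N).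
    by apply/orthc_sub/orthc_sub => _ [y _ <-]; exact: sub_val_mem.
  by apply; exact: UR.
- move=> v.
  (* Split [X2 y] as [(X2 y - D y) + D y]. [P1] kills the second part, and its pseudoinverse
     recovers the first from [P1 (X2 y)]; the second part is supplied by [U]. *)
  have G : (fun y => Defs.pinv P1 (sA1 (B12 A B y)) + U (sqrtop (schur A B) y)) = X2.
    apply/funext => y; rewrite UD -P1X2 -[X in P1 X](subrK (D y)).
    rewrite (linD _ _ (psd_lin pP1)) (_ : P1 (D y) = 0); last first.
      exact: (sub_val_mem (oproj N (X2 y))).
    rewrite addr0 pinvK ?subrK//; exact: psd_lin.
  rewrite /pushforward1 /pushforward2 /= G (adjE aX2) pinv_A11_sqrt.
  rewrite -sAX1 pinv_A11_sqrt.
  exact: oproj_H1_H2.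
Qed.

End CouplingBlocks.

End Form.
Theorem theorem6p5 (R : realType) (H : hilbertType R) (A B : covop H)
    (sepH : separable H) :
  (leadsto A B <->
   (subdim (range (sqrtop B) `&` cov_H2 A)
    <= subdim (nullsp (sqrtop B \o sqrtop A) `&` cov_H1 A))%E) /\
  (leadsto A B -> forall T : H -> H, optimal_pre_pushforward A B T ->
   exists U12 : subsp (cov_H2 A) -> subsp (cov_H1 A),
     [/\ partial_isometry U12,
         initial_space U12 = closure (range (schur A B)),
         range U12 `<=` nullsp (sqrtop (B11 A B) \o sqrtop (A11 A))
       & forall x : subsp (cov_H1 A), range (sqrtop A) (sub_val x) ->
           T (sub_val x)
           = sub_val (pushforward1 A B x) + sub_val (pushforward2 A B U12 x)]).
Proof.
split; first split.
- by move=> [T /(optimal_coupling sepH)]; exact: coupling_subdim.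
- by move=> /(subdim_coupling sepH)[S [S' cS]]; exact: coupling_optimal cS.
move=> _ T /(optimal_coupling sepH) cS.
have [U [U1 U2 U3 U4]] := coupling_form cS; exists U; split => // x [y _ yx].
have <- : sqrtop (A11 A) (oproj (cov_H1 A) y) = x.
  by apply: sub_val_inj; rewrite sub_val_sqrtop_A11 sqrtop_oproj_H1.
by rewrite -U4 /= sub_val_sqrtop_A11.
Qed.
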